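(* There exists a family of non-c-connected flat clustered graphs $C(G,T)$ whose underlying graph $G$ is outerplanar with $n$ vertices, for arbitrarily large $n$, such that $\gamma\in\Omega(n^2)$ in every $\langle 0,0,\gamma\rangle$-drawing of $C(G,T)$.
   Context: A clustered graph $C(G,T)$ consists of a graph $G$ and a rooted tree $T$ whose leaves are exactly the vertices of $G$; each internal node $\mu$ of $T$ is a cluster, identified with the set of leaves of its subtree. $C(G,T)$ is c-connected if for every cluster the subgraph of $G$ induced by its vertices is connected; it is flat if no cluster other than the root contains another cluster. A drawing of $C(G,T)$ maps vertices to distinct points, edges to open curves between their endpoints, and each cluster $\mu$ to a simple closed region $R(\mu)$ containing all and only the vertices of $\mu$, with $R(\nu)\supseteq R(\mu)$ whenever $\mu$ is a descendant of $\nu$. Intersections among curves are isolated points, no three curves meet at a point, and two curves alternate around each intersection point. Edge-edge crossings are crossings between two edges; an edge crossing the boundary of $R(\mu)$ exactly $k$ times contributes $\lfloor k/2\rfloor$ edge-region crossings; for clusters $\mu,\nu$ neither an ancestor of the other, the number of region-region crossings is the number of connected components of $R(\mu)\setminus R(\nu)$ minus one. A $\langle 0,0,\gamma\rangle$-drawing is a drawing with exactly $\gamma$ region-region crossings and no edge-edge or edge-region crossings. *)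

(* Defs.v *)
From HB Require Import structures.
From mathcomp Require Import all_boot all_order all_algebra.
From mathcomp Require Import all_classical all_reals all_analysis.

Set Implicit Arguments.
Unset Strict Implicit.
Unset Printing Implicit Defensive.

Import Order.TTheory GRing.Theory Num.Theory.
Import numFieldNormedType.Exports.

(* Finite simple graphs; an edge is the 2-element set of its endpoints. *)
Record graph := Graph {
  vertex :> finType;
  edges : {set {set vertex}};
  edge_card2 : forall e, e \in edges -> #|e| = 2 }.

Definition induced_connected (G : graph) (A : {set G}) : Prop :=
  forall u v : G, u \in A -> v \in A ->
    connect [rel x y : G | [&& x \in A, y \in A & [set x; y]%SET \in edges G]]
            u v.

(* The rooted tree is given by its parent function, with parent troot = troot.
   [leaf] is the identification of the vertices of the graph with the leaves. *)
Definition has_child (N : finType) (troot : N) (parent : N -> N) : pred N :=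
  fun x => [exists y, (y != troot) && (parent y == x)].

Record clustered_graph := ClusteredGraph {
  under :> graph;
  node : finType;
  troot : node;
  parent : node -> node;
  parent_root : parent troot = troot;
  connect_root : forall x, fconnect parent x troot;
  leaf : under -> node;
  leaf_inj : injective leaf;
  leafE : forall x, (x \in codom leaf) = ~~ has_child troot parent x }.

Section ClusteredGraph.
Variable C : clustered_graph.
Implicit Types mu nu : node C.

Definition is_cluster : pred (node C) := has_child (troot C) (@parent C).

(* reflexive *)
Definition descendant mu nu : bool := fconnect (@parent C) mu nu.

Definition incomparable mu nu : bool :=
  ~~ descendant mu nu && ~~ descendant nu mu.

Definition cluster_set mu : {set C} := [set v : C | descendant (leaf v) mu]%SET.

Definition c_connected : Prop :=
  forall mu, is_cluster mu -> induced_connected (cluster_set mu).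

Definition flat : Prop :=
  forall mu nu, is_cluster mu -> is_cluster nu ->
    mu != troot C -> nu != mu -> ~~ descendant nu mu.

End ClusteredGraph.

Local Open Scope classical_set_scope.
Local Open Scope ring_scope.

Notation plane R := (R * R)%type.

Section PlaneTopology.
Variable R : realType.
Implicit Types (c : R -> plane R) (A B J : set (plane R)) (p : plane R).

Definition simple_arc c : Prop :=
  {within `[0, 1], continuous c} /\ {in `[0, 1] &, injective c}.

Definition open_curve c : set (plane R) := c @` `]0, 1[.

Definition simple_closed_curve c : Prop :=
  [/\ {within `[0, 1], continuous c}, c 0 = c 1
    & {in `[0, 1[ &, injective c}].

Definition closed_curve c : set (plane R) := c @` `[0, 1].

Definition enclosed J : set (plane R) :=
  [set p | ~ J p /\ bounded_set (connected_component (~` J) p)].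

Definition closed_region c : set (plane R) :=
  closed_curve c `|` enclosed (closed_curve c).

Definition outer_face A : set (plane R) :=
  [set p | ~ A p /\ ~ bounded_set (connected_component (~` A) p)].

Definition components A : set (set (plane R)) :=
  [set connected_component A p | p in A].

(* [A] and [B] alternate around [p]: some homeomorphism [f], with inverse [g],
   from an open neighbourhood [U] of [p] onto the open square of centre 0
   sends [p] to 0 and [A] and [B] to the two coordinate axes. *)
Definition alternate_at A B p : Prop :=
  let Q : set (plane R) := [set q | -1 < q.1 < 1 /\ -1 < q.2 < 1] in
  exists U : set (plane R), exists f g : plane R -> plane R,
  [/\ open U /\ U p,
      {within U, continuous f} /\ {within Q, continuous g},
      (forall q, U q -> Q (f q) /\ g (f q) = q) /\
      (forall q, Q q -> U (g q) /\ f (g q) = q),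
      f p = (0, 0)
    & forall q, U q -> (A q <-> (f q).2 = 0) /\ (B q <-> (f q).1 = 0)].

End PlaneTopology.

Record graph_drawing (R : realType) (G : graph) := GraphDrawing {
  pos : G -> plane R;
  edge_arc : {set G} -> R -> plane R;
  pos_inj : injective pos;
  arc_simple : forall e, e \in edges G -> simple_arc (edge_arc e);
  arc_ends : forall e, e \in edges G ->
    [set edge_arc e 0; edge_arc e 1] = [set pos v | v in [set` e]];
  arc_avoid : forall e v, e \in edges G -> ~ open_curve (edge_arc e) (pos v) }.

Section GraphDrawing.
Variables (R : realType) (G : graph).
Implicit Type D : graph_drawing R G.

Definition planar_drawing D : Prop :=
  forall e e', e \in edges G -> e' \in edges G -> e != e' ->
    open_curve (edge_arc D e) `&` open_curve (edge_arc D e') = set0.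

Definition drawn_points D : set (plane R) :=
  range (pos D) `|` \bigcup_(e in [set` edges G]) open_curve (edge_arc D e).

Definition outerplanar : Prop :=
  exists2 D : graph_drawing R G, planar_drawing D &
    forall v, closure (outer_face (drawn_points D)) (pos D v).

End GraphDrawing.

Record drawing (R : realType) (C : clustered_graph) := Drawing {
  gdrawing :> graph_drawing R C;
  border : node C -> R -> plane R;
  region := fun mu => closed_region (border mu);
  border_simple : forall mu, is_cluster mu -> simple_closed_curve (border mu);
  region_vertex : forall mu v, is_cluster mu ->
    region mu (pos gdrawing v) <-> v \in cluster_set mu;
  region_nested : forall mu nu, is_cluster mu -> is_cluster nu ->
    descendant mu nu -> region mu `<=` region nu;
  (* The curves of the drawing are the open edges and the region borders. *)
  is_curve := fun x : {set C} + node C =>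
    match x with inl e => e \in edges C | inr mu => is_cluster mu end;
  curve := fun x : {set C} + node C =>
    match x with
    | inl e => open_curve (edge_arc gdrawing e)
    | inr mu => closed_curve (border mu)
    end;
  curves_isolated : forall x y, is_curve x -> is_curve y -> x != y ->
    curve x `&` curve y `<=` isolated (curve x `&` curve y);
  curves_alternate : forall x y p, is_curve x -> is_curve y -> x != y ->
    curve x p -> curve y p -> alternate_at (curve x) (curve y) p;
  curves_no_three : forall x y z, is_curve x -> is_curve y -> is_curve z ->
    x != y -> x != z -> y != z -> curve x `&` curve y `&` curve z = set0 }.

Section Crossings.
Local Open Scope card_scope.
Variables (R : realType) (C : clustered_graph) (D : drawing R C).

(* The sums over [enum_rank _ < enum_rank _] range over unordered pairs. *)
Definition edge_edge_crossings (a : nat) : Prop :=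
  exists2 k : {set C} -> {set C} -> nat,
    (forall e e', e \in edges C -> e' \in edges C -> e != e' ->
      open_curve (edge_arc D e) `&` open_curve (edge_arc D e') #= `I_(k e e')) &
    a = (\sum_(e in edges C)
           \sum_(e' in edges C | enum_rank e < enum_rank e') k e e')%N.

Definition edge_region_crossings (b : nat) : Prop :=
  exists2 k : {set C} -> node C -> nat,
    (forall e mu, e \in edges C -> is_cluster mu ->
      open_curve (edge_arc D e) `&` closed_curve (border D mu) #= `I_(k e mu)) &
    b = (\sum_(e in edges C) \sum_(mu | is_cluster mu) (k e mu)./2)%N.

Definition region_region_crossings (c : nat) : Prop :=
  exists2 k : node C -> node C -> nat,
    (forall mu nu, is_cluster mu -> is_cluster nu -> incomparable mu nu ->
      components (region D mu `\` region D nu) #= `I_(k mu nu).+1) &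
    c = (\sum_(mu | is_cluster mu)
           \sum_(nu | [&& is_cluster nu, incomparable mu nu
                        & (enum_rank mu < enum_rank nu)%N]) k mu nu)%N.

Definition crossing_drawing (a b c : nat) : Prop :=
  [/\ edge_edge_crossings a, edge_region_crossings b
    & region_region_crossings c].

End Crossings.

(* Main.v *)
Require Import Defs.
From mathcomp Require Import all_boot all_order all_algebra.
From mathcomp Require Import all_classical all_reals all_analysis.
From mathcomp Require Import ring lra zify.

(* The family consists of the cycles of length 2k whose clusters are the k pairs
   of antipodal vertices. Three of these pairs together with the cycle form a
   subdivision of K_{3,3}, so among any three clusters two must have regions
   whose difference is disconnected; averaging over the triples gives a
   quadratic number of region-region crossings.

   Non-planarity of K_{3,3} is derived from a parity argument for chains, that
   is, finite sequences of points with small steps. For a vertex v and a chain x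
   avoiding it, count modulo 2 the steps of x crossing the horizontal ray issued
   from v. If two chains are disjoint (and fine with respect to their distance),
   the four counts of an endpoint of one against the other add up to a quantity
   that depends on the endpoints only: this is the vanishing of the winding
   number around the boundary of a square. The sum of these relations over the 18
   independent pairs of edges of K_{3,3} reads 0 = 1.

   Connected sets contain fine chains, so regions can be used in place of arcs,
   and the count of v against a region is well defined since v escapes to
   infinity in the complement. An edge may touch a region it should avoid, but
   in one point at most, and a region stays connected when a point of its border
   is removed. *)

Set Implicit Arguments.
Unset Strict Implicit.
Unset Printing Implicit Defensive.

Import Order.TTheory GRing.Theory Num.Theory.
Import numFieldNormedType.Exports.

(** * Parities on the complete bipartite graph and on a cycle *)

Local Open Scope ring_scope.

Lemma big_addb_telescope (g : nat -> bool) (a b : nat) : (a <= b)%N ->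
  \big[addb/false]_(a <= i < b) (g i (+) g i.+1) = g a (+) g b.
Proof.
elim: b => [|b IH]; first by rewrite leqn0 => /eqP ->; rewrite big_geq// addbb.
rewrite leq_eqVlt => /orP[/eqP <-|ab]; first by rewrite big_geq// addbb.
by rewrite big_nat_recr//= IH// addbA addbK.
Qed.

Section KThreeThree.
Local Open Scope nat_scope.

(* [N v e] is the parity attached to the vertex [v] and the edge [e], and
   [t u v] compares the vertices [u] and [v]; an edge is given by its two
   endpoints and its name. *)
Definition parity_eq (N t : nat -> nat -> bool) (e f : nat * nat * nat) : Prop :=
  let: (a, b, e) := e in let: (c, d, f) := f in
  ((N a f + N b f) + (N c e + N d e) = (t a c + t b c) + (t a d + t b d))%R.

(* The hexagon 1...6 has the edges 1...6, the long diagonals are 7, 8, 9; the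
   hypotheses run through the independent pairs. In their sum each [N v e]
   occurs twice and each [t u v] with [u < v] an even number of times, but [t]
   has to be reversed 21 times. *)
Lemma K33_parity (N t : nat -> nat -> bool) :
  (forall u v, 0 < u < v -> v <= 6 -> t v u = (1 + t u v)%R) ->
  parity_eq N t (1, 2, 1) (3, 4, 3) ->
  parity_eq N t (1, 2, 1) (4, 5, 4) ->
  parity_eq N t (1, 2, 1) (5, 6, 5) ->
  parity_eq N t (2, 3, 2) (4, 5, 4) ->
  parity_eq N t (2, 3, 2) (5, 6, 5) ->
  parity_eq N t (2, 3, 2) (6, 1, 6) ->
  parity_eq N t (3, 4, 3) (5, 6, 5) ->
  parity_eq N t (3, 4, 3) (6, 1, 6) ->
  parity_eq N t (4, 5, 4) (6, 1, 6) ->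
  parity_eq N t (1, 4, 7) (2, 3, 2) ->
  parity_eq N t (1, 4, 7) (5, 6, 5) ->
  parity_eq N t (2, 5, 8) (3, 4, 3) ->
  parity_eq N t (2, 5, 8) (6, 1, 6) ->
  parity_eq N t (3, 6, 9) (1, 2, 1) ->
  parity_eq N t (3, 6, 9) (4, 5, 4) ->
  parity_eq N t (1, 4, 7) (2, 5, 8) ->
  parity_eq N t (1, 4, 7) (3, 6, 9) ->
  parity_eq N t (2, 5, 8) (3, 6, 9) ->
  False.
Proof.
move=> anti.
have sum (x y x' y' : bool) : x = y -> x' = y' -> (x + x' = y + y')%R by move=> -> ->.
rewrite /parity_eq.
do 17![move=> h /(sum _ _ _ _ h) {h}].
rewrite ?(anti 1 2)// ?(anti 1 3)// ?(anti 1 4)// ?(anti 1 5)// ?(anti 1 6)//.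
rewrite ?(anti 2 3)// ?(anti 2 4)// ?(anti 2 5)// ?(anti 2 6)// ?(anti 3 4)//.
rewrite ?(anti 3 5)// ?(anti 3 6)// ?(anti 4 5)// ?(anti 4 6)// ?(anti 5 6)//.
pose zN := (
  N 1 2 + N 1 3 + N 1 4 + N 1 5 + N 1 8 + N 1 9 + N 2 3 + N 2 4 + N 2 5 +
  N 2 6 + N 2 7 + N 2 9 + N 3 1 + N 3 4 + N 3 5 + N 3 6 + N 3 7 + N 3 8 +
  N 4 1 + N 4 2 + N 4 5 + N 4 6 + N 4 8 + N 4 9 + N 5 1 + N 5 2 + N 5 3 +
  N 5 6 + N 5 7 + N 5 9 + N 6 1 + N 6 2 + N 6 3 + N 6 4 + N 6 7 + N 6 8)%R.
pose zt := (
  2%:R * t 1 2 + 3%:R * t 1 3 + 2%:R * t 1 4 + 3%:R * t 1 5 + 2%:R * t 1 6 +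
  2%:R * t 2 3 + 3%:R * t 2 4 + 2%:R * t 2 5 + 3%:R * t 2 6 + 2%:R * t 3 4 +
  3%:R * t 3 5 + 2%:R * t 3 6 + 2%:R * t 4 5 + 3%:R * t 4 6 + 2%:R * t 5 6 +
  10%:R)%R.
have dbl (x : bool) : (x + x = 0)%R by exact: addbb.
rewrite [X in X = _](_ : _ = zN + zN)%R; last by rewrite /zN; ring.
rewrite [X in _ = X](_ : _ = 1 + (zt + zt))%R; last by rewrite /zt; ring.
by rewrite !dbl.
Qed.

End KThreeThree.

(** * Parity relations between paths and clusters of a cycle *)

Section Cycle.
Local Open Scope nat_scope.
Variables (k : nat) (T w t : nat -> nat -> bool).

(** [T v q] stands for the parity of the vertex [v] against the cycle edge from [q] to [q.+1], and
    [w m v] for its parity against the region of the cluster [m]. A block is the parity against a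
    subdivided edge of K_{3,3}. *)
Definition block (v a b : nat) : bool := \big[addb/false]_(a <= q < b) T v q.

(** The bound [k * 4] allows paths that wrap around, and leaves finitely many relations, so that one
    sampling fineness can serve them all. *)
Hypothesis edge_edge : forall p q, q < k * 4 -> p.+1 < q -> q.+1 < p + k.*2 ->
  (T p q (+) T p.+1 q) (+) (T q p (+) T q.+1 p) =
  (t p q (+) t p.+1 q) (+) (t p q.+1 (+) t p.+1 q.+1).

(** The relations are summed over the rectangle of pairs [(p, q)]; the inner vertices of both paths
    cancel. *)
Lemma block_block a b c d : d <= k * 4 -> a <= b < c -> c <= d < a + k.*2 ->
  (block a c d (+) block b c d) (+) (block c a b (+) block d a b) =
  (t a c (+) t b c) (+) (t a d (+) t b d).
Proof.
move=> dk /andP[ab bc] /andP[cd da].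
have : \big[addb/false]_(a <= p < b) \big[addb/false]_(c <= q < d)
    ((T p q (+) T p.+1 q) (+) (T q p (+) T q.+1 p)) =
  \big[addb/false]_(a <= p < b) \big[addb/false]_(c <= q < d)
    ((t p q (+) t p.+1 q) (+) (t p q.+1 (+) t p.+1 q.+1)).
  rewrite big_nat [RHS]big_nat; apply: eq_bigr => p pab.
  rewrite big_nat [RHS]big_nat; apply: eq_bigr => q qcd.
  by apply: edge_edge; lia.
have step p : \big[addb/false]_(c <= q < d)
    ((t p q (+) t p.+1 q) (+) (t p q.+1 (+) t p.+1 q.+1)) =
    (t p c (+) t p d) (+) (t p.+1 c (+) t p.+1 d).
  rewrite -(big_addb_telescope (t p) cd) -(big_addb_telescope (t p.+1) cd).
  by rewrite -big_split; apply: eq_bigr => q _; rewrite addbACA.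
under [X in _ = X -> _]eq_bigr => p _ do rewrite step.
rewrite (big_addb_telescope (fun p => t p c (+) t p d))// => h.
rewrite [RHS]addbACA -h.
under [RHS]eq_bigr => p _ do rewrite big_split /=.
rewrite big_split /=; congr (_ (+) _).
  rewrite exchange_big /= /block -big_split /=.
  by apply: eq_bigr => q _; rewrite (big_addb_telescope (fun p => T p q)).
rewrite /block -big_split /=.
by apply: eq_bigr => p _; rewrite (big_addb_telescope (fun q => T q p)).
Qed.

Hypothesis cluster_edge : forall m q, m < k -> q < k * 4 ->
  q.+1 < m \/ (m < q /\ q.+1 < m + k) \/ (m + k < q /\ q.+1 < m + k.*2) ->
  (T m q (+) T (m + k) q) (+) (w m q (+) w m q.+1) =
  (t m q (+) t (m + k) q) (+) (t m q.+1 (+) t (m + k) q.+1).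

Lemma cluster_block m a b : m < k -> b <= k * 4 -> a <= b ->
  b < m \/ (m < a /\ b < m + k) \/ (m + k < a /\ b < m + k.*2) ->
  (block m a b (+) block (m + k) a b) (+) (w m a (+) w m b) =
  (t m a (+) t (m + k) a) (+) (t m b (+) t (m + k) b).
Proof.
move=> mk bk ab mab.
rewrite -(big_addb_telescope (w m) ab).
rewrite -(big_addb_telescope (fun q => t m q (+) t (m + k) q) ab).
rewrite /block -!big_split /= big_nat [RHS]big_nat; apply: eq_bigr => q qab.
by apply: cluster_edge => //; lia.
Qed.

Hypothesis T_period : forall v q, T (v + k.*2) q = T v q.
Hypothesis w_period : forall m v, w m (v + k.*2) = w m v.
Hypothesis t_period : forall u v, t u (v + k.*2) = t u v.
Hypothesis t_anti : forall u v, u < v < k.*2 -> t v u = ~~ t u v.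

(** This is [parity_eq] for two long diagonals, each cluster acting as an edge between its two
    antipodal vertices. *)
Definition clusters_parity m m' : Prop :=
  (w m' m (+) w m' (m + k)) (+) (w m m' (+) w m (m' + k)) =
  (t m m' (+) t (m + k) m') (+) (t m (m' + k) (+) t (m + k) (m' + k)).

(** Along the cycle the six vertices come in the order [i, j, l, i + k, j + k, l + k], so the three
    clusters join opposite corners of a hexagon. *)
Lemma cycle_clusters_cross i j l : i < j < l -> l < k ->
  clusters_parity i j -> clusters_parity i l -> clusters_parity j l -> False.
Proof.
move=> ijl lk cij cil cjl.
(* The leading 0 makes the numbering start from 1; the last entry is corner 1 after a full turn,
   where the sixth side ends. *)
pose V := nth 0 [:: 0; i; j; l; i + k; j + k; l + k; i + k.*2].
pose N v e := if e <= 6 then block (V v) (V e) (V e.+1) else w (V (e - 6)) (V v).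
have period a b : block (i + k.*2) a b = block i a b.
  by apply: eq_bigr => q _; rewrite T_period.
apply: (@K33_parity N (fun u v => t (V u) (V v))).
  by case=> [|[|[|[|[|[|u]]]]]] [|[|[|[|[|[|[|v]]]]]]] // _ _; rewrite /V /= t_anti //; lia.
all: rewrite /parity_eq /N /V /=.
all: rewrite -?[GRing.add]/addb.
- by apply: block_block; lia.
- by apply: block_block; lia.
- by apply: block_block; lia.
- by apply: block_block; lia.
- by apply: block_block; lia.
(* In a pair involving the sixth side, corner 1 is read as [i + k.*2] by periodicity, so that the
   indices increase. *)
- by rewrite -period -(t_period j i) -(t_period l i); apply: block_block; lia.
- by apply: block_block; lia.
- by rewrite -period -(t_period l i) -(t_period (i + k) i); apply: block_block; lia.
- by rewrite -period -(t_period (i + k) i) -(t_period (j + k) i); apply: block_block; lia.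
- by apply: cluster_block; lia.
- by apply: cluster_block; lia.
- by apply: cluster_block; lia.
- by rewrite -(w_period j i) -(t_period j i) -(t_period (j + k) i); apply: cluster_block; lia.
- by apply: cluster_block; lia.
- by apply: cluster_block; lia.
- exact: cij.
- exact: cil.
- exact: cjl.
Qed.

End Cycle.

(** * Cycles clustered into antipodal pairs *)

Local Close Scope ring_scope.

Section CycleGraph.
Variable k : nat.
Hypothesis k_gt2 : 2 < k.
Local Notation n := k.*2.

Let n_gt0 : 0 < n. Proof. by lia. Qed.
Let k_gt0 : 0 < k. Proof. by lia. Qed.

Definition vtx (q : nat) : 'I_n := Ordinal (ltn_pmod q n_gt0).

Lemma vtx_eq p q : (vtx p == vtx q) = (p == q %[mod n]).
Proof. by []. Qed.

Lemma vtxK (v : 'I_n) : vtx v = v.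
Proof. by apply: val_inj; rewrite /= modn_small. Qed.

Lemma vtxD q : vtx (q + n) = vtx q.
Proof. by apply: val_inj; rewrite /= modnDr. Qed.

Lemma vtx_neq p q : p < q -> q < p + n -> vtx p != vtx q.
Proof.
move=> pq qn; rewrite vtx_eq eq_sym eqn_mod_dvd; last exact: ltnW.
by apply/negP => /dvdn_leq; lia.
Qed.

Definition cycle_edge (q : nat) : {set 'I_n} := [set vtx q; vtx q.+1].

Definition cycle_edges : {set {set 'I_n}} := [set cycle_edge q | q : 'I_n].

Lemma cycle_edge_in q : cycle_edge q \in cycle_edges.
Proof.
apply/imsetP; exists (vtx q) => //; rewrite /cycle_edge vtxK.
by congr [set _; _]; apply: val_inj => /=; rewrite -[in RHS]addn1 modnDml addn1.
Qed.

Lemma cycle_edge_card2 e : e \in cycle_edges -> #|e| = 2.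
Proof. by case/imsetP => q _ ->; rewrite cards2 vtx_neq //; lia. Qed.

Definition cycle_graph : graph := Graph cycle_edge_card2.

Definition cluster_of (q : nat) : 'I_k := Ordinal (ltn_pmod q k_gt0).

Lemma cluster_of_vtx q : cluster_of (vtx q) = cluster_of q.
Proof. by apply: val_inj; rewrite /= modn_dvdm // -muln2 dvdn_mulr. Qed.

(** [None] is the root, [inl] gives the clusters and [inr] the leaves. *)
Definition antipodal_node : finType := option ('I_k + 'I_n).

Definition antipodal_parent (x : antipodal_node) : antipodal_node :=
  if x is Some (inr v) then Some (inl (cluster_of v)) else None.

Definition antipodal_leaf (v : cycle_graph) : antipodal_node := Some (inr v).

Lemma antipodal_connect_root x : fconnect antipodal_parent x None.
Proof.
by case: x => [[m|v]|]; [exact: (fconnect_iter _ 1)|exact: (fconnect_iter _ 2)|].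
Qed.

Lemma antipodal_leaf_inj : injective antipodal_leaf.
Proof. by move=> u v []. Qed.

Definition antipodal_cluster (x : antipodal_node) : bool :=
  if x is Some (inr _) then false else true.

Lemma antipodal_has_child : has_child None antipodal_parent =1 antipodal_cluster.
Proof.
case=> [[m|v]|]; apply/existsP => /=.
- exists (Some (inr (vtx m))) => /=; rewrite cluster_of_vtx; apply/eqP.
  by congr (Some (inl _)); apply: val_inj; rewrite /= modn_small.
- by case=> -[[m|u]|].
- by exists (Some (inl (cluster_of 0))).
Qed.

Lemma antipodal_leafE x :
  (x \in codom antipodal_leaf) = ~~ has_child None antipodal_parent x.
Proof.
rewrite antipodal_has_child; case: x => [[m|v]|] /=.
- by apply/codomP => -[].
- by apply/codomP; exists v.
- by apply/codomP => -[].
Qed.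

Definition antipodal_cycle : clustered_graph :=
  @ClusteredGraph cycle_graph antipodal_node None antipodal_parent erefl
    antipodal_connect_root antipodal_leaf antipodal_leaf_inj antipodal_leafE.

Definition cluster_node (q : nat) : node antipodal_cycle :=
  Some (inl (cluster_of q)).

Lemma antipodal_descendant (x y : node antipodal_cycle) :
  descendant x y = (y \in [:: x; parent x; None]).
Proof.
apply/idP/idP => [xy|]; last first.
  rewrite !inE => /or3P[] /eqP ->; first exact: connect0.
    exact: (fconnect_iter _ 1).
  exact: antipodal_connect_root.
rewrite -(iter_findex xy); case: (findex _ _ _) => [|[|i]].
- by rewrite !inE eqxx.
- by rewrite !inE eqxx orbT.
suff -> : iter i.+2 (@parent antipodal_cycle) x = None by rewrite !inE eqxx !orbT.
elim: i => [|i IH]; first by case: (x) => [[]|].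
by rewrite iterS IH.
Qed.

Lemma is_clusterE (x : node antipodal_cycle) : is_cluster x = antipodal_cluster x.
Proof. exact: antipodal_has_child. Qed.

Lemma cluster_node_is_cluster q : is_cluster (cluster_node q).
Proof. by rewrite is_clusterE. Qed.

Lemma in_cluster_node v q :
  (v \in cluster_set (cluster_node q)) = (cluster_of v == cluster_of q).
Proof.
rewrite inE antipodal_descendant !inE /= orbF.
by apply/eqP/eqP => [[e]|e]; [exact/esym/val_inj|rewrite /cluster_node e].
Qed.

Lemma cluster_of_neq p q : p < q -> q < p + k -> cluster_of p != cluster_of q.
Proof.
move=> pq qk; rewrite -val_eqE /= eq_sym eqn_mod_dvd; last exact: ltnW.
by apply/negP => /dvdn_leq; lia.
Qed.

Lemma cluster_ofD q : cluster_of (q + k) = cluster_of q.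
Proof. by apply: val_inj; rewrite /= modnDr. Qed.

Lemma incomparable_cluster_node p q :
  cluster_of p != cluster_of q -> incomparable (cluster_node p) (cluster_node q).
Proof.
move=> pq; rewrite /incomparable !antipodal_descendant !inE /= !orbF.
by apply/andP; split; apply: contraNN pq => /eqP[e]; apply/eqP; apply: val_inj; rewrite /= e.
Qed.

Lemma antipodal_flat : flat antipodal_cycle.
Proof.
case=> [[m|v]|] nu //; first last.
  by rewrite is_clusterE.
move=> _ + _ nm; rewrite is_clusterE antipodal_descendant.
by case: nu nm => [[m'|v]|] //; rewrite !inE eq_sym => /negbTE ->.
Qed.

(** A path between the two vertices of a cluster would begin with a cycle edge inside it, but
    consecutive vertices lie in distinct clusters. *)
Lemma antipodal_not_c_connected : ~ c_connected antipodal_cycle.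
Proof.
move=> /(_ (cluster_node 0) (cluster_node_is_cluster 0)) /(_ (vtx 0) (vtx k)).
have ck : cluster_of k = cluster_of 0 by rewrite -[RHS]cluster_ofD.
rewrite !in_cluster_node !cluster_of_vtx ck eqxx.
move=> /(_ isT isT) /connectP[[|y s]] /=.
  by move=> _ k0; have := @vtx_neq 0 k; rewrite -k0 eqxx; lia.
case/andP=> /and3P[_ yA /imsetP[q _ qE]] _ _.
have A0 : vtx 0 \in cluster_set (cluster_node 0).
  by rewrite in_cluster_node cluster_of_vtx.
have inA u : u \in cycle_edge q -> cluster_of u = cluster_of 0.
  rewrite -qE => /set2P[] ->; last by apply/eqP; rewrite -in_cluster_node.
  by rewrite cluster_of_vtx.
have := inA (vtx q) (set21 _ _); have := inA (vtx q.+1) (set22 _ _).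
rewrite !cluster_of_vtx => e1 e2.
by have := @cluster_of_neq q q.+1; rewrite e1 e2 eqxx; lia.
Qed.

End CycleGraph.

Local Open Scope classical_set_scope.
Local Open Scope ring_scope.

(** * Crossing parities of chains *)

Section Crossing.
Variable R : realType.
Implicit Types (u v w : plane R) (x y : nat -> plane R).

(* Breaking the tie [u.2 = 0] lexicographically makes [upper (- u)] the
   negation of [upper u] for every [u != 0]. *)
Definition upper u : bool := (0 < u.2) || ((u.2 == 0) && (0 < u.1)).

(* For nearby vectors: does the step from [u] to [w] cross the ray of positive
   abscissae? *)
Definition ray_step u w : bool := (upper u != upper w) && (0 < u.1).

Definition ray_parity v x (n : nat) : bool :=
  \big[addb/false]_(0 <= i < n) ray_step (x i - v) (x i.+1 - v).

Lemma upperN u : u != 0 -> upper (- u) = ~~ upper u.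
Proof.
case: u => a b; rewrite /upper /= => ab0.
have : (a != 0) || (b != 0).
  by apply: contraNT ab0; rewrite negb_or !negbK => /andP[/eqP -> /eqP ->].
by rewrite !oppr_gt0 oppr_eq0; case: (ltrgtP b 0); case: (ltrgtP a 0).
Qed.

Lemma prod_norm_lt u (r : R) : (`|u| < r) = (`|u.1| < r) && (`|u.2| < r).
Proof. by rewrite prod_normE gt_max. Qed.

Lemma prod_norm_ge u (r : R) : (r <= `|u|) = (r <= `|u.1|) || (r <= `|u.2|).
Proof. by rewrite prod_normE le_max. Qed.

(** The norm is the maximum norm: a change of half-plane forces the ordinate of [u] below [r], so
    the abscissa carries the norm. *)
Lemma upper_change (r : R) u w :
  `|u - w| < r -> r <= `|u| -> upper u != upper w -> r <= `|u.1|.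
Proof.
rewrite prod_norm_lt prod_norm_ge => /andP[_ h] /orP[//|h2] uw; exfalso.
move: h h2 uw; rewrite /upper ltr_norml ler_normr /= => /andP[h1 h2] h3.
by case/orP: h3 => h3; case: (ltrgtP u.2 0); case: (ltrgtP w.2 0) => //= *; lra.
Qed.

Lemma same_side (r a b : R) :
  r <= `|a| -> r <= `|b| -> `|a - b| < r -> (0 < a) = (0 < b).
Proof.
case: (ger0P a); case: (ger0P b); case: (ger0P (a - b)) => *; apply/idP/idP; lra.
Qed.

(** If both half-planes occur, any two corners in different ones lie on the same side of the
    vertical axis, hence all four do. The changes of half-plane around the square, even in number,
    are thus all counted or all ignored. *)
Lemma ray_step_cell (r : R) u00 u10 u01 u11 :
  r <= `|u00| -> r <= `|u10| -> r <= `|u01| -> r <= `|u11| ->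
  `|u00 - u10| < r -> `|u00 - u01| < r -> `|u00 - u11| < r ->
  `|u10 - u01| < r -> `|u10 - u11| < r -> `|u01 - u11| < r ->
  ray_step u00 u10 (+) ray_step u01 u11 =
  ray_step u00 u01 (+) ray_step u10 u11.
Proof.
move=> n00 n10 n01 n11 d1 d2 d3 d4 d5 d6.
have sd (u w : plane R) : `|u - w| < r -> r <= `|u| -> r <= `|w| ->
    upper u != upper w -> (0 < u.1) = (0 < w.1).
  move=> d nu nw uw; apply: (@same_side r).
  - exact: upper_change uw.
  - by apply: upper_change nw _; [rewrite distrC; exact: d|rewrite eq_sym].
  - by move: d; rewrite prod_norm_lt => /andP[].
have := sd _ _ d1 n00 n10; have := sd _ _ d2 n00 n01; have := sd _ _ d3 n00 n11.
have := sd _ _ d4 n10 n01; have := sd _ _ d5 n10 n11; have := sd _ _ d6 n01 n11.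
rewrite /ray_step.
case: (upper u00); case: (upper u10); case: (upper u01); case: (upper u11) => //=
  h1 h2 h3 h4 h5 h6;
repeat match goal with H : is_true _ -> _ |- _ =>
  first [rewrite (H erefl); clear H | clear H] end; by rewrite ?addbb ?addbF.
Qed.

(** Negation exchanges the positive and the negative ray, and a step changing half-plane crosses
    exactly one of them because [u.1] is not 0. *)
Lemma ray_stepN (r : R) u w : 0 < r -> r <= `|u| -> r <= `|w| -> `|u - w| < r ->
  ray_step (- u) (- w) = ray_step u w (+) (upper u (+) upper w).
Proof.
move=> r0 nu nw d.
have [u0 w0] : u != 0 /\ w != 0 by rewrite -!normr_gt0 !(lt_le_trans r0).
rewrite /ray_step !upperN// -[(- u).1]/(- u.1) oppr_gt0.
have := upper_change d nu.
case: (upper u) (upper w) => -[]//= /(_ erefl) h;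
  by move: h; case: (ltrgtP u.1 0) => // ->; rewrite normr0; lra.
Qed.

(** The scale [r] is local to a pair of steps, since a chain may have to shorten its steps where it
    comes close to the other. *)
Definition fine_pair x (n : nat) y (m : nat) : Prop :=
  forall i j, (i < n)%N -> (j < m)%N -> exists r : R,
  [/\ 0 < r, forall a b : bool, r <= `|x (a + i)%N - y (b + j)%N|,
      `|x i - x i.+1| < r / 2 & `|y j - y j.+1| < r / 2].

(** The vectors [x i - y j] form a grid. Each cell has winding number zero by [ray_step_cell], hence
    so has the boundary of the grid, whose four sides give the four parities. *)
Lemma ray_parityE x n y m : (0 < n)%N -> (0 < m)%N -> fine_pair x n y m ->
  (ray_parity (x 0%N) y m (+) ray_parity (x n) y m) (+)
  (ray_parity (y 0%N) x n (+) ray_parity (y m) x n) =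
  (upper (x 0%N - y 0%N) (+) upper (x n - y 0%N)) (+)
  (upper (x 0%N - y m) (+) upper (x n - y m)).
Proof.
move=> n0 m0 xy.
pose u i j := x i - y j.
have cell i j : (i < n)%N -> (j < m)%N ->
    ray_step (u i j) (u i.+1 j) (+) ray_step (u i j.+1) (u i.+1 j.+1) =
    ray_step (u i j) (u i j.+1) (+) ray_step (u i.+1 j) (u i.+1 j.+1).
  move=> iN jM; have [r [r0 h dx dy]] := xy _ _ iN jM.
  have e1 j' : u i j' - u i.+1 j' = x i - x i.+1 by rewrite /u opprB addrA subrK.
  have e2 i' : u i' j - u i' j.+1 = - (y j - y j.+1).
    by rewrite /u opprB addrC addrA subrK opprB.
  have dx' : `|x i - x i.+1| < r by lra.
  have dy' : `|y j - y j.+1| < r by lra.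
  have tri (a b c : plane R) : `|a - b| < r / 2 -> `|b - c| < r / 2 -> `|a - c| < r.
    by move=> h1 h2; apply: le_lt_trans (ler_distD b a c) _; lra.
  apply: (@ray_step_cell r); rewrite ?e1 ?e2 ?normrN//.
  - exact: (h false false).
  - exact: (h true false).
  - exact: (h false true).
  - exact: (h true true).
  - by apply: (tri _ (u i.+1 j)); rewrite ?e1 ?e2 ?normrN.
  - by rewrite distrC; apply: (tri _ (u i j)); rewrite ?e1 ?e2 ?normrN// distrC e2 normrN.
have {cell} : \big[addb/false]_(0 <= j < m)
    ((ray_parity (y j) x n (+) ray_parity (y j.+1) x n) (+)
     (ray_step (u 0%N j) (u 0%N j.+1) (+) ray_step (u n j) (u n j.+1))) = false.
  rewrite big_nat big1// => j /= jm.
  rewrite -(big_addb_telescope (fun i => ray_step (u i j) (u i j.+1)))//.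
  rewrite /ray_parity -!big_split/= big_nat big1// => i /= iN.
  by rewrite cell// addbb.
rewrite big_split /= big_addb_telescope// big_split /=.
(* On these two sides the vectors are opposite to those of [ray_parity]; [ray_stepN] corrects each
   step and the corrections telescope into the [upper] terms. *)
have side i : (i <= n)%N -> \big[addb/false]_(0 <= j < m) ray_step (u i j) (u i j.+1)
    = ray_parity (x i) y m (+) (upper (x i - y 0%N) (+) upper (x i - y m)).
  move=> iN; rewrite -(big_addb_telescope (fun j => upper (x i - y j)))//.
  rewrite /ray_parity -big_split/= big_nat [RHS]big_nat; apply: eq_bigr => j /= jm.
  (* [fine_pair] is indexed by steps while [i] may be [n], so row [i] is viewed as an edge of some
     cell. *)
  have [i' [b i'N ->]] : exists i', exists2 b : bool, (i' < n)%N & i = (b + i')%N.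
    case: i iN => [|i] iN; first by exists 0%N, false.
    by exists i, true.
  have [r [r0 h dx dy]] := xy _ _ i'N jm.
  rewrite /u -[in LHS]opprB -[X in ray_step _ X]opprB (@ray_stepN r)//.
  - congr (_ (+) _).
    rewrite -(opprB (y j)) -(opprB (y j.+1)) !upperN; first by case: (upper _); case: (upper _).
    - by rewrite -normr_gt0 distrC (lt_le_trans r0)// (h b true).
    - by rewrite -normr_gt0 distrC (lt_le_trans r0)// (h b false).
  - by rewrite distrC (h b false).
  - by rewrite distrC (h b true).
  - by rewrite opprB addrA subrK; lra.
rewrite !side//.
move: (ray_parity (x 0%N) _ _) (ray_parity (x n) _ _) => b1 b2.
move: (ray_parity (y 0%N) _ _) (ray_parity (y m) _ _) => b3 b4.
move: (upper (x 0%N - y 0%N)) (upper (x 0%N - y m)) => b5 b6.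
move: (upper (x n - y 0%N)) (upper (x n - y m)) => b7 b8.
by case: b1; case: b2; case: b3; case: b4; case: b5; case: b6; case: b7; case: b8.
Qed.

End Crossing.

(** * Fine chains in connected sets and along arcs *)

Section Chains.
Variable R : realType.
Implicit Types (a b p q : plane R) (x y : nat -> plane R) (A B K : set (plane R)).

Lemma nbhs_planeP A p : nbhs p A <->
  exists2 e : R, 0 < e & forall q, `|p - q| < e -> A q.
Proof.
split=> [/nbhs_normP[e /= e0 eA]|[e e0 eA]]; first by exists e => // q /eA.
by apply: (nbhs_normP p A).2; exists e.
Qed.

Lemma open_normP A p : open A -> A p ->
  exists2 e : R, 0 < e & forall q, `|p - q| < e -> A q.
Proof.
by rewrite openE => Ao /Ao /nbhs_planeP.
Qed.

Lemma closed_dist B p : closed B -> ~ B p ->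
  exists2 e : R, 0 < e & forall q, B q -> e <= `|p - q|.
Proof.
move=> /closed_openC cB pB; have [e e0 h] := open_normP cB pB.
by exists e => // q Bq; rewrite leNgt; apply/negP => /h.
Qed.

Lemma closure_normP A p : closure A p <->
  forall e : R, 0 < e -> exists2 q, A q & `|p - q| < e.
Proof.
split=> [cA e e0|h B /nbhs_planeP[e e0 eB]].
  have [|q [Aq /= pq]] := cA [set q | `|p - q| < e]; last by exists q.
  by apply/nbhs_planeP; exists e.
by have [q Aq pq] := h _ e0; exists q; split => //; exact: eB.
Qed.

Definition chain_in A x (n : nat) : Prop := forall i, (i <= n)%N -> A (x i).

Definition mesh (e : R) x (n : nat) : Prop :=
  forall i, (i < n)%N -> `|x i - x i.+1| < e.

Lemma mesh_le (e e' : R) x n : e <= e' -> mesh e x n -> mesh e' x n.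
Proof. by move=> ee h i /h /lt_le_trans; exact. Qed.

(* The step size may depend on the point: this is what lets a chain approach a
   closed set that is not at positive distance from [K]. *)
Lemma connected_chain K (eps : plane R -> R) a b :
  connected K -> (forall p, 0 < eps p) -> K a -> K b ->
  exists x n, [/\ (0 < n)%N, x 0%N = a, x n = b, chain_in K x n &
    forall i, (i < n)%N ->
      `|x i - x i.+1| < eps (x i) \/ `|x i - x i.+1| < eps (x i.+1)].
Proof.
move=> cK eps0 Ka Kb.
(* The points reachable from [a] form an open and closed part of [K]: openness uses the step bound
   at the departure point, closedness the one at the arrival point, hence the disjunction. *)
pose S := [set c | exists x n, [/\ (0 < n)%N, x 0%N = a, x n = c, chain_in K x n &
    forall i, (i < n)%N ->
      `|x i - x i.+1| < eps (x i) \/ `|x i - x i.+1| < eps (x i.+1)]].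
have Sstep c d : S c -> K d -> `|c - d| < eps c \/ `|c - d| < eps d -> S d.
  move=> [x [n [n0 x0 xn xK xe]]] Kd cd.
  exists (fun i => if (i <= n)%N then x i else d), n.+1; split => //=.
  - by rewrite ltnn.
  - by move=> i _; case: ifP => // /xK.
  - move=> i; rewrite ltnS => iN; rewrite iN; case: ltnP => [/xe//|ni].
    by have -> : i = n; [lia | rewrite xn].
have SK : S `<=` K by move=> c [x [n [_ _ <- xK _]]]; exact: xK.
suff KS : S = K by move: Kb; rewrite -[X in X b]KS.
apply: cK.
- exists a, (fun=> a), 1%N; split => // i _; left; rewrite subrr normr0//.
- exists (\bigcup_(c in S) [set d | `|c - d| < eps c]).
    apply: bigcup_open => c _; rewrite openE => d /= cd; apply/nbhs_planeP.
    exists (eps c - `|c - d|) => /=; first by rewrite subr_gt0.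
    move=> d' /= dd'; apply: le_lt_trans (ler_distD d _ _) _; lra.
  apply/seteqP; split=> [c Sc|c [Kc [d Sd /= dc]]].
    by split; [exact: SK|exists c => //=; rewrite subrr normr0].
  by apply: (Sstep d) => //; left.
- exists (closure S); first exact: closed_closure.
  apply/seteqP; split=> [c Sc|c [Kc /closure_normP/(_ _ (eps0 c))[d Sd dc]]].
    by split; [exact: SK|exact: subset_closure].
  by apply: (Sstep d) => //; right; rewrite distrC.
Qed.

Lemma finite_pos_lower (r : nat -> R) n : (forall i, (i < n)%N -> 0 < r i) ->
  exists2 e : R, 0 < e & forall i, (i < n)%N -> e <= r i.
Proof.
elim: n => [|n IH] h; first by exists 1.
have [i iN|e e0 eh] := IH; first by apply: h; lia.
exists (Num.min e (r n)); first by rewrite lt_min e0 h.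
move=> i; rewrite ltnS leq_eqVlt => /orP[/eqP ->|/eh]; first by rewrite ge_min lexx orbT.
by rewrite ge_min => ->.
Qed.

(** The steps of [x] are kept below a quarter of the distance to [B], so [K] may come arbitrarily
    close to [B]. Once the finite chain [x] is fixed, a single mesh [e] works for all chains in
    [B]. *)
Lemma chain_fine_pair K B a b (eta : R) : 0 < eta ->
  connected K -> closed B -> (forall p, K p -> ~ B p) -> K a -> K b ->
  exists x n, [/\ (0 < n)%N, x 0%N = a, x n = b, chain_in K x n & mesh eta x n /\
    exists2 e : R, 0 < e & forall y m,
      chain_in B y m -> mesh e y m -> fine_pair x n y m].
Proof.
move=> eta0 cK cB KB Ka Kb.
have /choice[eps epsP] : forall p, exists e : R,
    [/\ 0 < e, e <= eta & K p -> forall q, B q -> 4 * e <= `|p - q|].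
  move=> p; have [Kp|nKp] := pselect (K p); last by exists eta; split.
  have [e e0 eB] := closed_dist cB (KB _ Kp).
  exists (Num.min (e / 4) eta); split.
  - by rewrite lt_min; apply/andP; split; lra.
  - by rewrite ge_min lexx orbT.
  - move=> _ q /eB; apply: le_trans.
    have : Num.min (e / 4) eta <= e / 4 by rewrite ge_min lexx.
    lra.
have [x [n [n0 x0 xn xK xe]]] := @connected_chain K eps a b cK
  (fun p => let: And3 h _ _ := epsP p in h) Ka Kb.
exists x, n; split => //; split.
  by move=> i /xe[]/lt_le_trans; apply; have [] := epsP (x i); have [] := epsP (x i.+1).
have /choice[r rP] : forall i, exists r : R, (i < n)%N -> [/\ 0 < r,
    `|x i - x i.+1| < r / 2, forall q, B q -> r <= `|x i - q|
    & forall q, B q -> r <= `|x i.+1 - q|].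
  move=> i; have [iN|_] := ltnP i n; last by exists 0.
  have far (p p' : plane R) : K p -> `|p - p'| < eps p ->
      forall q, B q -> 3 * eps p <= `|p' - q|.
    move=> Kp pp' q Bq; have [_ _ /(_ Kp _ Bq)] := epsP p.
    have := ler_distD p' p q; lra.
  have far0 (p : plane R) : K p -> forall q, B q -> 3 * eps p <= `|p - q|.
    move=> Kp q Bq; have [e0 _ /(_ Kp _ Bq)] := epsP p; lra.
  have Kx : K (x i) by apply: xK; lia.
  have Kx' : K (x i.+1) by apply: xK; lia.
  (* Both ends of the step are at distance at least [3 * eps] from [B], with [eps] taken at the end
     that bounds the step, and the step is shorter than half of this. *)
  have [h|h] := xe _ iN.
    exists (3 * eps (x i)) => _; have [e0 _ _] := epsP (x i).
    by split; [lra|lra|exact: far0|exact: far].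
  exists (3 * eps (x i.+1)) => _; have [e0 _ _] := epsP (x i.+1).
  by split; [lra|lra|apply: far => //; rewrite distrC|exact: far0].
have [|e e0 eP] := @finite_pos_lower (fun i => r i / 2) n.
  by move=> i /rP[r0 _ _ _]; rewrite divr_gt0.
exists e => // y m yB ye i j iN jm; exists (r i).
have [r0 h1 h2 h3] := rP _ iN; split => //; last exact: lt_le_trans (ye _ jm) (eP _ iN).
by move=> [] []; rewrite ?add1n ?add0n; do ?[apply: h2|apply: h3]; apply: yB; lia.
Qed.

Lemma dist_fine_pair (d : R) x n y m : 0 < d ->
  (forall i j, (i <= n)%N -> (j <= m)%N -> d <= `|x i - y j|) ->
  mesh (d / 2) x n -> mesh (d / 2) y m -> fine_pair x n y m.
Proof.
move=> d0 h hx hy i j iN jm; exists d; split => //; [|exact: hx|exact: hy].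
by move=> a b; apply: h; case: a; case: b; lia.
Qed.

Lemma compact_dist A B : compact A -> compact B -> (forall p, A p -> ~ B p) ->
  exists2 d : R, 0 < d & forall p q, A p -> B q -> d <= `|p - q|.
Proof.
move=> cA cB AB.
have [[[p q] /= [Ap Bq]]|AB0] := pselect ((A `*` B) !=set0); last first.
  by exists 1 => // p q Ap Bq; exfalso; apply: AB0; exists (p, q).
have [||[p0 q0] /=] := @compact_EVT_min _ R (fun z : plane R * plane R => `|z.1 - z.2|)
    (A `*` B) _ (compact_setX cA cB).
- by exists (p, q).
- apply: continuous_subspaceT => z.
  by apply: (@cvg_norm _ (plane R)); apply: cvgB; [exact: cvg_fst|exact: cvg_snd].
rewrite inE /= => -[Ap0 Bq0] h; exists `|p0 - q0|.
  rewrite normr_gt0 subr_eq0; apply/eqP => pq0; apply: (AB p0) => //.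
  by rewrite pq0.
by move=> p' q' Ap' Bq'; have := h (p', q'); rewrite inE; apply.
Qed.

Definition arc_chain (c : R -> plane R) (N : nat) (i : nat) : plane R :=
  c (i%:R / N%:R).

Lemma ratio_itv (N i : nat) : (0 < N)%N -> (i <= N)%N ->
  `[0, 1]%classic (i%:R / N%:R : R).
Proof.
move=> N0 iN; rewrite /= in_itv/= divr_ge0//= ler_pdivrMr ?ltr0n//.
by rewrite mul1r ler_nat.
Qed.

Lemma arc_chain_mesh (c : R -> plane R) (e : R) :
  {within `[0, 1], continuous c} -> 0 < e ->
  \forall N \near \oo, mesh e (arc_chain c N) N.
Proof.
move=> cc e0.
have : compact `[0 : R, 1]%classic by exact: segment_compact.
move=> /compact_near_coveringP /(_ nat \oo (fun N t => `[0,1]%classic t ->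
  forall t' : R, `[0, 1]%classic t' -> `|t - t'| <= N%:R^-1 -> `|c t - c t'| < e)).
move=> /(_ _); case.
  move=> t t01.
  have /subspace_continuousP/(_ t t01) := cc.
  have e20 : 0 < e / 2 by lra.
  move=> /(@cvgr_dist_lt _ (plane R))/(_ _ e20).
  rewrite !near_withinE => /nbhs_normP[d /= d0 dP].
  (* With [d / 2], both parameters stay within [d] of [t]: one lies in the neighbourhood, the other
     is within [N%:R^-1 < d / 2] of it. *)
  exists ([set t' | `|t - t'| < d / 2], [set N | 2 / d < N%:R]).
    split; first by apply/nbhs_normP; exists (d / 2); rewrite //= divr_gt0.
    exact: nbhs_infty_gtr.
  move=> [t' N] /= [tt' Nd] t'01 t'' t''01 t't''.
  have N0 : (0 : R) < N%:R by apply: lt_trans Nd; rewrite divr_gt0.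
  have h1 : N%:R^-1 < d / 2.
    by rewrite -[d / 2]invrK ltf_pV2 ?posrE ?invr_gt0 ?divr_gt0// invf_div.
  have := dP t' _ t'01; have := dP t'' _ t''01; rewrite /ball_/=.
  have := ler_distD t' t t''; have := ler_distD (c t) (c t') (c t'').
  rewrite (distrC (c t') (c t)) => k1 k2 k3 k4.
  have := k3 ltac:(lra); have := k4 ltac:(lra); lra.
move=> N0 _ hN; exists (maxn N0 1) => // N /=; rewrite geq_max => /andP[NN0 N1].
move=> i iN; rewrite /arc_chain.
apply: (hN N NN0 _ (ratio_itv N1 (ltnW iN)) (ratio_itv N1 (ltnW iN)) _ (ratio_itv N1 iN)).
rewrite -mulrBl -natr1 opprD addrA subrr add0r mulN1r normrN ger0_norm//.
Qed.

End Chains.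

(** * Regions bounded by closed curves *)

Section PlaneSets.
Variable R : realType.
Implicit Types (a b p q v : plane R) (A J P : set (plane R)).

Lemma bounded_planeP A : bounded_set A <->
  exists M : R, forall p, A p -> `|p| <= M.
Proof.
split=> [/pinfty_ex_gt0[M M0 AM]|[M AM]]; first by exists M.
exists M; split; first exact: num_real.
by move=> M' /ltW MM' p Ap; exact: le_trans (AM p Ap) MM'.
Qed.

Lemma connected_line (I : set R) (p d : plane R) : is_interval I ->
  connected [set p + t *: d | t in I].
Proof.
move=> /connected_intervalP cI; apply: connected_continuous_connected => //.
apply: continuous_subspaceT => t.
by apply: cvgD; [exact: cvg_cst|apply: cvgZl; exact: cvg_id].
Qed.

Lemma component_nbhs A p q : open A -> connected_component A p q ->
  exists2 e : R, 0 < e & forall q', `|q - q'| < e -> connected_component A p q'.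
Proof.
move=> oA Apq; have Aq := connected_component_sub Apq.
have [e e0 eA] := open_normP oA Aq; exists e => // q' qq'.
apply: (connected_component_trans Apq).
exists [set q + t *: (q' - q) | t in `[0, 1]%classic].
  split; last by apply: connected_line; exact: interval_is_interval.
  - by exists 0; [rewrite /= in_itv /= lexx ler01|rewrite scale0r addr0].
  - move=> _ [t /= +] <-; rewrite in_itv /= => /andP[t0 t1].
    apply: eA; rewrite opprD addrA subrr sub0r normrN normrZ ger0_norm//.
    by rewrite distrC; apply: le_lt_trans qq'; rewrite ler_piMl.
by exists 1; [rewrite /= in_itv /= lexx ler01|rewrite scale1r addrC subrK].
Qed.

Lemma component_open A p : open A -> open (connected_component A p).
Proof.
by move=> oA; rewrite openE => q /(component_nbhs oA) /nbhs_planeP.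
Qed.

Lemma connected_adherent (U : set (plane R)) q :
  connected U -> closure U q -> connected (U `|` [set q]).
Proof.
move=> cU Uq B [b Bb] [V oV BV] [C cC BC].
have capUr E : U `&` ((U `|` [set q]) `&` E) = U `&` E.
  by rewrite setIA; congr (_ `&` _); apply/seteqP; split => z; [case|split => //; left].
have [[u [Uu Bu]]|UB] := pselect ((U `&` B) !=set0).
  have UBU : U `&` B = U.
    apply: cU; first by exists u.
      by exists V => //; rewrite BV; exact: capUr.
    by exists C => //; rewrite BC; exact: capUr.
  have UC : U `<=` C by move=> z; rewrite -UBU BC => -[_ []].
  apply/seteqP; split; first by rewrite BC => z [].
  move=> z Uz; rewrite BC; split => //; case: Uz => [/UC//|->].
  by apply: cC; exact: closureS Uq.
exfalso; apply: UB; have := Bb; rewrite {1}BV => -[[Ub|bq] Vb]; first by exists b.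
have [|z [Uz Vz]] := Uq V; first by rewrite -bq; exact: open_nbhs_nbhs.
by exists z; split => //; rewrite BV; split => //; left.
Qed.

Lemma closure_component_sub A p q : open A -> A q ->
  closure (connected_component A p) q -> connected_component A p q.
Proof.
move=> oA Aq cq; have [e e0 eP] := component_nbhs oA (connected_component_refl Aq).
have [q' Apq' qq'] := (closure_normP _ _).1 cq _ e0.
apply: (connected_component_trans Apq'); apply: connected_component_sym.
exact: eP.
Qed.

(** Otherwise the trace of the component on the half-line from [p] along [d] is open and closed, and
    a bounded component contains the whole half-line. *)
Lemma enclosed_boundary J p (d : plane R) : closed J -> enclosed J p -> d != 0 ->
  exists2 t : R, 0 < t & J (p + t *: d) /\
    closure (connected_component (~` J) p) (p + t *: d).
Proof.
move=> cJ [nJp /bounded_planeP[M UM]] d0; set U := connected_component _ _ in UM *.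
have oJ : open (~` J) by exact: closed_openC.
pose L := [set p + t *: d | t in `[0, +oo[%classic].
have Lp : L p by exists 0; [rewrite /= in_itv /= lexx|rewrite scale0r addr0].
have Up : U p by exact: connected_component_refl.
apply: contrapT => nex.
have LU z : L z -> closure U z -> U z.
  move=> [t /= +] <-; rewrite in_itv /= andbT => t0 cz.
  apply: (closure_component_sub oJ) => // Jz; apply: nex.
  exists t => //; rewrite lt_neqAle t0 andbT; apply/eqP => t00.
  by apply: nJp; move: Jz; rewrite -t00 scale0r addr0.
have LL : L `&` U = L.
  apply: (connected_line (@interval_is_interval _ `[0, +oo[)).
  - by exists p.
  - by exists U => //; exact: component_open.
  - exists (closure U); first exact: closed_closure.
    apply/seteqP; split=> z [Lz Uz]; split => //; last exact: LU.
    exact: subset_closure.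
pose t := (`|p| + `|M| + 1) / `|d|.
have dp : 0 < `|d| by rewrite normr_gt0.
have t0 : 0 <= t by rewrite divr_ge0// addr_ge0// addr_ge0.
have : U (p + t *: d).
  have : L (p + t *: d) by exists t => //=; rewrite in_itv /= t0.
  by rewrite -LL => -[].
move=> /UM; have := ler_normD (p + t *: d) (- p).
rewrite addrAC subrr add0r normrN normrZ (ger0_norm t0) /t divfK ?gt_eqF//.
by have := ler_norm M; have := normr_ge0 p; lra.
Qed.

End PlaneSets.

Section Region.
Variables (R : realType) (c : R -> plane R).
Hypothesis ccont : {within `[0, 1], continuous c}.
Implicit Types (a b p q v : plane R) (P : set (plane R)).
Local Notation J := (closed_curve c).
Local Notation D := (closed_region c).

Lemma closed_curve_compact : compact J.
Proof. by apply: continuous_compact => //; exact: segment_compact. Qed.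

Lemma closed_curve_closed : closed J.
Proof. by apply: compact_closed closed_curve_compact; exact: norm_hausdorff. Qed.

Let oJ : open (~` J) := closed_openC closed_curve_closed.

Lemma notin_regionP p :
  ~ D p <-> ~ J p /\ ~ bounded_set (connected_component (~` J) p).
Proof.
split=> [nD|[nJ nb]]; last by case=> // -[].
have nJ : ~ J p by move=> ?; apply: nD; left.
by split => // b; apply: nD; right.
Qed.

Lemma notin_region_component p q :
  ~ D p -> connected_component (~` J) p q -> ~ D q.
Proof.
move=> /notin_regionP[nJ nb] pq; apply/notin_regionP; split.
  exact: (connected_component_sub pq).
by rewrite -(same_connected_component pq).
Qed.

Lemma closed_region_closed : closed D.
Proof.
rewrite -openC openE => p nDp; apply/nbhs_planeP.
have [nJ _] := (notin_regionP p).1 nDp.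
have [e e0 eP] := component_nbhs oJ (connected_component_refl (nJ : (~` J) p)).
by exists e => // q /eP; exact: notin_region_component.
Qed.

(** A point farther from the origin than the whole curve escapes to infinity along its own
    radius. *)
Lemma closed_region_bounded : exists M : R, forall p, D p -> `|p| <= M.
Proof.
have /bounded_planeP[M JM] := compact_bounded closed_curve_compact.
exists `|M| => p [/JM pM|[nJp /bounded_planeP[M' UM]]].
  exact: le_trans pM (ler_norm _).
rewrite leNgt; apply/negP => Mp.
have p0 : 0 < `|p| by apply: le_lt_trans Mp.
pose t := (`|M'| + 1) / `|p|.
have t0 : 0 <= t by rewrite divr_ge0// addr_ge0.
have : connected_component (~` J) p (p + t *: p).
  exists [set p + t *: p | t in `[0, +oo[%classic].
    split; last by apply: connected_line; exact: interval_is_interval.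
    - by exists 0; [rewrite /= in_itv /= lexx|rewrite scale0r addr0].
    - move=> _ [s /= +] <- /JM; rewrite in_itv /= andbT => s0.
      rewrite -[X in X + _]scale1r -scalerDl normrZ ger0_norm ?addr_ge0// mulrDl mul1r.
      have : 0 <= s * `|p| by rewrite mulr_ge0.
      by have := ler_norm M; lra.
  by exists t => //=; rewrite in_itv /= t0.
move=> /UM; rewrite -[X in X + _]scale1r -scalerDl normrZ ger0_norm ?addr_ge0// mulrDl mul1r.
rewrite /t divfK ?gt_eqF//.
by have := ler_norm M'; lra.
Qed.

(** From an enclosed point, two opposite half-lines reach two distinct points of [J] adherent to its
    component; at least one of them is not removed and links the component to the rest of the
    curve. *)
Lemma region_diff_connected P : P `<=` J -> (forall p q, P p -> P q -> p = q) ->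
  connected (J `\` P) -> (J `\` P) !=set0 -> connected (D `\` P).
Proof.
move=> PJ P1 cJP [j JPj].
have reach z : (D `\` P) z -> exists2 A : set (plane R), A z /\ A j &
    A `<=` D `\` P /\ connected A.
  move=> [[Jz|ez] nPz].
    by exists (J `\` P) => //; split => // q [Jq nPq]; split => //; left.
  set U := connected_component (~` J) z.
  have [q [Jq nPq] Uq] : exists2 q, (J `\` P) q & closure U q.
    have d0 : ((1, 0) : plane R) != 0 by apply/eqP => -[/eqP]; rewrite oner_eq0.
    have [t t0 [Jt Ut]] := enclosed_boundary closed_curve_closed ez d0.
    have [s s0 [Js Us]] := enclosed_boundary closed_curve_closed ez
      (etrans (congr1 negb (oppr_eq0 _)) d0 : - ((1, 0) : plane R) != 0).
    have [Pt|nPt] := pselect (P (z + t *: (1, 0))); last by exists (z + t *: (1, 0)).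
    have [Ps|nPs] := pselect (P (z + s *: - (1, 0))); last by exists (z + s *: - (1, 0)).
    have /addrI := P1 _ _ Pt Ps; rewrite scalerN => -[].
    rewrite -![_ *: _]/(_ * _) !mulr1; lra.
  exists ((J `\` P) `|` (U `|` [set q])).
    by split; [right; left; apply: connected_component_refl; case: ez|left].
  split; last first.
    apply: connectedU => //; first by exists q; split => //; right.
    by apply: connected_adherent => //; exact: component_connected.
  move=> r [[Jr nPr]|[Ur|->]]; split => //; try by left.
  - right; have [nJz Ub] := ez; split; first exact: (connected_component_sub Ur).
    by rewrite -(same_connected_component Ur).
  - by move=> /PJ; exact: (connected_component_sub Ur).
have -> : D `\` P = connected_component (D `\` P) j.
  apply/seteqP; split; last exact: connected_component_sub.
  by move=> z /reach[A [Az Aj] [AD cA]]; exists A.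
exact: component_connected.
Qed.

End Region.

Section PuncturedRegion.
Variables (R : realType) (c : R -> plane R).
Hypothesis csimple : simple_closed_curve c.
Local Notation J := (closed_curve c).
Local Notation D := (closed_region c).

Lemma closed_curve_image_connected (i : interval R) :
  [set` i] `<=` `[0, 1]%classic -> connected (c @` [set` i]).
Proof.
move=> sub; apply: connected_continuous_connected.
  by apply/connected_intervalP; exact: interval_is_interval.
by case: csimple => cc _ _; exact: continuous_subspaceW cc.
Qed.

Lemma closed_curve_connected : connected J.
Proof. exact: closed_curve_image_connected. Qed.

Lemma closed_curveE p : J p -> exists2 t : R, 0 <= t < 1 & p = c t.
Proof.
case: csimple => _ c01 _ [t /=]; rewrite in_itv /= => /andP[t0 t1] <-.
have [->|t1'] := eqVneq t 1; last by exists t => //; rewrite t0 lt_neqAle t1' t1.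
by exists 0; rewrite ?lexx ?ltr01// c01.
Qed.

Lemma closed_curve_inj (s t : R) : 0 <= s < 1 -> 0 <= t < 1 -> c s = c t -> s = t.
Proof. by case: csimple => _ _ ci hs ht; apply: ci; rewrite in_itv. Qed.

(** What remains is an open arc if the removed parameter is 0, and otherwise two half-open arcs
    sharing the point [c 0 = c 1]. *)
Lemma closed_curveD1_connected p : J p -> connected (J `\ p).
Proof.
move=> /closed_curveE[t /andP[t0 t1] ->]; have [_ c01 _] := csimple.
have tt : 0 <= t < 1 by rewrite t0.
have [t00|t0'] := eqVneq t 0.
  have -> : J `\ c t = c @` `]0, 1[%classic.
    apply/seteqP; split=> [_ [/closed_curveE[s /andP[s0 s1] ->] /= st]|_ [s /= + <-]].
      exists s => //=; rewrite in_itv /= s1 andbT lt_neqAle s0 andbT.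
      by apply/eqP => s00; apply: st; rewrite -s00 t00.
    rewrite in_itv /= => /andP[s0 s1]; split.
      by exists s => //=; rewrite in_itv /= !ltW.
    move=> /= /closed_curve_inj st.
    have {}st : s = t by apply: st => //; rewrite (ltW s0).
    by move: s0; rewrite st t00 ltxx.
  by apply: closed_curve_image_connected => s /=; rewrite !in_itv /= => /andP[/ltW -> /ltW ->].
have tp : 0 < t by rewrite lt_neqAle eq_sym t0'.
have -> : J `\ c t = (c @` `[0, t[%classic) `|` (c @` `]t, 1]%classic).
  apply/seteqP; split=> [_ [/closed_curveE[s /andP[s0 s1] ->] /= st]|z].
    have [ts|ts|ts] := ltrgtP s t.
    - by left; exists s => //=; rewrite in_itv /= s0.
    - by right; exists s => //=; rewrite in_itv /= ts ltW.
    - by rewrite ts in st.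
  case=> -[s /=]; rewrite in_itv /= => /andP[h1 h2] <-; split.
  - by exists s => //=; rewrite in_itv /= h1 (ltW (lt_trans h2 t1)).
  - move=> /= /closed_curve_inj st.
    have {}st : s = t by apply: st => //; rewrite h1 (lt_trans h2).
    by move: h2; rewrite st ltxx.
  - by exists s => //=; rewrite in_itv /= h2 (ltW (lt_trans tp h1)).
  - move=> /=; have [->|s1] := eqVneq s 1.
      rewrite -c01 => /closed_curve_inj st; move/eqP: t0'; apply.
      by apply/esym/st; rewrite ?lexx ?ltr01.
    move=> /closed_curve_inj st.
    have {}st : s = t by apply: st => //; rewrite (ltW (lt_trans tp h1)) lt_neqAle s1.
    by move: h1; rewrite st ltxx.
apply: connectedU.
- exists (c 0); split; first by exists 0; rewrite //= in_itv /= lexx.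
  by exists 1; rewrite //= in_itv /= lexx t1.
- apply: closed_curve_image_connected => s /=; rewrite !in_itv /= => /andP[-> h] /=.
  exact: ltW (lt_trans h t1).
- apply: closed_curve_image_connected => s /=; rewrite !in_itv /= => /andP[h ->].
  by rewrite (ltW (lt_trans tp h)).
Qed.

Lemma closed_curveD1_nonempty p : (J `\ p) !=set0.
Proof.
have J0 : J (c 0) by exists 0; rewrite //= in_itv /= lexx ler01.
have Jh : J (c 2^-1) by exists 2^-1 => //=; rewrite in_itv /=; lra.
have [cp|cp] := pselect (c 0 = p); last by exists (c 0).
exists (c 2^-1); split => //=; rewrite -cp => /closed_curve_inj h.
have : (2^-1 : R) = 0 by apply: h; lra.
lra.
Qed.

Lemma punctured_region_connected (P : set (plane R)) :
  P `<=` J -> (forall p q, P p -> P q -> p = q) -> connected (D `\` P).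
Proof.
move=> PJ P1; have [cc _ _] := csimple.
have [[p Pp]|P0] := pselect (P !=set0).
  have PE : P = [set p] by apply/seteqP; split=> [q Pq|q ->//]; exact: P1.
  apply: region_diff_connected => //; rewrite PE.
    exact: closed_curveD1_connected (PJ _ Pp).
  exact: closed_curveD1_nonempty.
have -> : P = set0 by apply/seteqP; split=> // q Pq; apply: P0; exists q.
rewrite setD0 -(setD0 D); apply: region_diff_connected => //; rewrite setD0.
  exact: closed_curve_connected.
by exists (c 0), 0; rewrite //= in_itv /= lexx ler01.
Qed.

End PuncturedRegion.

(** * Parities of points against arcs and regions *)

Section Winding.
Variable R : realType.
Implicit Types (a b v z : plane R) (x y : nat -> plane R) (c e f : R -> plane R).

(** If [z] lies to the left of the square containing the chain, every change of half-plane is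
    counted and the changes telescope; if it lies to the right, above or below, nothing is
    counted. *)
Lemma ray_parity_far (M : R) a b z : M < `|z| ->
  exists w : bool, forall x n, (0 < n)%N -> x 0%N = a -> x n = b ->
    (forall i, (i <= n)%N -> `|x i| <= M) -> ray_parity z x n = w.
Proof.
have lep (p : plane R) : (`|p| <= M) = (`|p.1| <= M) && (`|p.2| <= M).
  by rewrite prod_normE ge_max.
have [z1|z1] := ltP z.1 (- M).
  exists (upper (a - z) (+) upper (b - z)) => x n n0 x0 xn xM.
  rewrite -x0 -xn -(big_addb_telescope (fun i => upper (x i - z)))//.
  rewrite /ray_parity big_nat [RHS]big_nat; apply: eq_bigr => i /= iN.
  have := xM i (ltnW iN); rewrite lep ler_norml => /andP[/andP[h _] _].
  rewrite /ray_step -[(x i - z).1]/((x i).1 - z.1).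
  have -> : 0 < (x i).1 - z.1 by lra.
  by case: (upper _); case: (upper _).
move=> zM; exists false => x n n0 _ _ xM.
rewrite /ray_parity big_nat big1// => i /= iN; rewrite /ray_step.
have := xM i (ltnW iN); have := xM i.+1 iN; rewrite !lep !ler_norml.
move=> /andP[/andP[h1 h2] /andP[h3 h4]] /andP[/andP[h5 h6] /andP[h7 h8]].
rewrite /upper -![(_ - z).1]/(_.1 - z.1) -![(_ - z).2]/(_.2 - z.2).
move: zM; rewrite ltNge lep => /nandP[]; rewrite -ltNge lter_normr => /orP[] k.
- by apply/negbTE; rewrite negb_and -leNgt; apply/orP; right; lra.
- by exfalso; lra.
- have -> : (0 < (x i).2 - z.2) = false by apply/negbTE; rewrite -leNgt; lra.
  have -> : (0 < (x i.+1).2 - z.2) = false by apply/negbTE; rewrite -leNgt; lra.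
  have -> : ((x i).2 - z.2 == 0) = false by apply/negbTE/eqP; lra.
  by have -> : ((x i.+1).2 - z.2 == 0) = false by apply/negbTE/eqP; lra.
- have -> : 0 < (x i).2 - z.2 by lra.
  by have -> : 0 < (x i.+1).2 - z.2 by lra.
Qed.

(** The region serves as an edge from [a] to [b]; its parity is the value common to all fine enough
    chains in it. *)
Definition winds c a b v (w : bool) : Prop :=
  exists2 eta : R, 0 < eta & forall x n, (0 < n)%N -> x 0%N = a -> x n = b ->
    chain_in (closed_region c) x n -> mesh eta x n -> ray_parity v x n = w.

(* A region has no holes: [v] escapes to infinity in its complement. *)
Lemma region_winds c a b v : {within `[0, 1], continuous c} ->
  ~ closed_region c v -> exists w, winds c a b v w.
Proof.
move=> cc nDv.
have [M DM] := closed_region_bounded cc.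
have [nJv nb] := (notin_regionP c v).1 nDv.
set U := connected_component (~` closed_curve c) v in nb.
have [z Uz zM] : exists2 z, U z & M < `|z|.
  apply: contrapT => h; apply: nb; apply/bounded_planeP; exists M => z Uz.
  by rewrite leNgt; apply/negP => Mz; apply: h; exists z.
have Uv : U v by exact: connected_component_refl.
have [] := @chain_fine_pair R U (closed_region c) v z 1 ltr01 _ _ _ Uv Uz.
- exact: component_connected.
- exact: closed_region_closed.
- by move=> p; exact: notin_region_component.
move=> y [m [m0 y0 ym yU [_ [e e0 he]]]].
have [w0 w0P] := ray_parity_far a b zM.
(* This value is solved from [ray_parityE] for the chain [y] from [v] to the far point [z]; it does
   not depend on the chain [x]. *)
exists ((w0 (+) (ray_parity a y m (+) ray_parity b y m)) (+)
  ((upper (v - a) (+) upper (z - a)) (+) (upper (v - b) (+) upper (z - b)))).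
exists e => // x n n0 x0 xn xD xe.
have := ray_parityE m0 n0 (he _ _ xD xe); rewrite y0 ym x0 xn.
rewrite (w0P x n)//; last by move=> i iN; exact: DM (xD _ iN).
move: (ray_parity v x n) (ray_parity a y m) (ray_parity b y m) => b1 b2 b3.
move: (upper (v - a) (+) _ (+) _) => b4.
by case: b1; case: b2; case: b3; case: b4; case: w0 {w0P}.
Qed.

Definition arc_parity v e (N : nat) : bool := ray_parity v (arc_chain e N) N.

Lemma arc_chain0 e N : arc_chain e N 0 = e 0.
Proof. by rewrite /arc_chain mul0r. Qed.

Lemma arc_chainN e N : (0 < N)%N -> arc_chain e N N = e 1.
Proof. by move=> N0; rewrite /arc_chain divff// pnatr_eq0 -lt0n. Qed.

Lemma arc_chain_in e N : (0 < N)%N ->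
  chain_in (e @` `[0, 1]%classic) (arc_chain e N) N.
Proof. by move=> N0 i iN; exists (i%:R / N%:R) => //; exact: ratio_itv. Qed.

Lemma arc_arc_parity e f :
  {within `[0, 1], continuous e} -> {within `[0, 1], continuous f} ->
  (forall s t : R, 0 <= s <= 1 -> 0 <= t <= 1 -> e s <> f t) ->
  \forall N \near \oo,
  (arc_parity (e 0) f N (+) arc_parity (e 1) f N) (+)
  (arc_parity (f 0) e N (+) arc_parity (f 1) e N) =
  (upper (e 0 - f 0) (+) upper (e 1 - f 0)) (+)
  (upper (e 0 - f 1) (+) upper (e 1 - f 1)).
Proof.
move=> ce cf ef.
have [] := @compact_dist R (e @` `[0, 1]%classic) (f @` `[0, 1]%classic).
- by apply: continuous_compact => //; exact: segment_compact.
- by apply: continuous_compact => //; exact: segment_compact.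
- move=> _ [s /= + <-] [t /= + fe]; rewrite !in_itv /= => hs ht.
  exact: ef hs ht (esym fe).
move=> d d0 dP; have d20 : 0 < d / 2 by lra.
have me := arc_chain_mesh ce d20; have mf := arc_chain_mesh cf d20.
near=> N.
have N0 : (0 < N)%N by near: N; exact: nbhs_infty_gt.
have := @ray_parityE R (arc_chain e N) N (arc_chain f N) N N0 N0.
rewrite !arc_chain0 !arc_chainN//; apply.
apply: (dist_fine_pair d0).
- by move=> i j iN jN; apply: dP; exact: arc_chain_in.
- by near: N.
- by near: N.
Unshelve. all: by end_near. Qed.

(** The region stays connected without its touching point, so it contains a chain avoiding the arc;
    the arc is sampled after this chain is fixed. *)
Lemma region_arc_parity c a b (P : set (plane R)) e w0 w1 :
  simple_closed_curve c -> closed_region c a -> closed_region c b ->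
  P `<=` closed_curve c -> (forall p q, P p -> P q -> p = q) -> ~ P a -> ~ P b ->
  {within `[0, 1], continuous e} ->
  (forall t : R, 0 <= t <= 1 -> closed_region c (e t) -> P (e t)) ->
  winds c a b (e 0) w0 -> winds c a b (e 1) w1 ->
  \forall N \near \oo,
  (arc_parity a e N (+) arc_parity b e N) (+) (w0 (+) w1) =
  (upper (a - e 0) (+) upper (b - e 0)) (+) (upper (a - e 1) (+) upper (b - e 1)).
Proof.
move=> sc Da Db PJ P1 nPa nPb ce eP [eta0 h0 H0] [eta1 h1 H1].
have eta : 0 < Num.min eta0 eta1 by rewrite lt_min h0.
have [] := @chain_fine_pair R (closed_region c `\` P) (e @` `[0, 1]%classic) a b _ eta.
- exact: punctured_region_connected.
- apply: compact_closed; first exact: norm_hausdorff.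
  by apply: continuous_compact => //; exact: segment_compact.
- by move=> p [Dp nPp] [t /= + etp]; rewrite in_itv /= => /eP; rewrite etp => /(_ Dp).
- by [].
- by [].
move=> x [n [n0 x0 xn xD [xe [d d0 hd]]]].
have xD' : chain_in (closed_region c) x n by move=> i /xD[].
have me := arc_chain_mesh ce d0.
near=> N.
have N0 : (0 < N)%N by near: N; exact: nbhs_infty_gt.
have := @ray_parityE R x n (arc_chain e N) N n0 N0.
rewrite x0 xn !arc_chain0 !arc_chainN// (H0 x n)// ?(H1 x n)//.
- apply; apply: hd; first exact: arc_chain_in.
  by near: N.
- by apply: mesh_le xe; rewrite ge_min lexx orbT.
- by apply: mesh_le xe; rewrite ge_min lexx.
Unshelve. all: by end_near. Qed.

(** The chain for [c] is taken in one component of the difference, hence avoids the region of [f]; a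
    fine enough chain in the latter completes the pair. *)
Lemma region_region_parity c f a b a' b' w0 w1 w0' w1' :
  simple_closed_curve c -> simple_closed_curve f ->
  closed_region f a' -> closed_region f b' ->
  connected_component (closed_region c `\` closed_region f) a b ->
  winds c a b a' w0 -> winds c a b b' w1 ->
  winds f a' b' a w0' -> winds f a' b' b w1' ->
  (w0' (+) w1') (+) (w0 (+) w1) =
  (upper (a - a') (+) upper (b - a')) (+) (upper (a - b') (+) upper (b - b')).
Proof.
move=> sc sf Fa Fb Kb [eta0 h0 H0] [eta1 h1 H1] [eta0' h0' H0'] [eta1' h1' H1'].
set K := connected_component _ _ in Kb.
have [cf _ _] := sf.
have KD p : K p -> closed_region c p /\ ~ closed_region f p.
  by move=> /connected_component_sub[].
have Ka : K a by exact: connected_component_trans Kb (connected_component_sym Kb).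
have eta : 0 < Num.min eta0 eta1 by rewrite lt_min h0.
have [] := @chain_fine_pair R K (closed_region f) a b _ eta.
- exact: component_connected.
- exact: closed_region_closed.
- by move=> p /KD[].
- exact: Ka.
- exact: Kb.
move=> x [n [n0 x0 xn xK [xe [d d0 hd]]]].
have xD : chain_in (closed_region c) x n by move=> i /xK/KD[].
pose eps := Num.min d (Num.min eta0' eta1').
have eps0 : 0 < eps by rewrite !lt_min d0 h0' h1'.
have cF : connected (closed_region f).
  by rewrite -(setD0 (closed_region f)); apply: punctured_region_connected.
have [y [m [m0 y0 ym yF ye]]] := connected_chain cF (fun=> eps0) Fa Fb.
have {}ye : mesh eps y m by move=> i /ye[].
have := @ray_parityE R x n y m n0 m0.
rewrite x0 xn y0 ym (H0 x n)// ?(H1 x n)// ?(H0' y m)// ?(H1' y m)//.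
- by apply; apply: hd => //; apply: mesh_le ye; rewrite ge_min lexx.
- by apply: mesh_le ye; rewrite !ge_min lexx !orbT.
- by apply: mesh_le ye; rewrite !ge_min lexx !orbT.
- by apply: mesh_le xe; rewrite ge_min lexx orbT.
- by apply: mesh_le xe; rewrite ge_min lexx.
Qed.

End Winding.

(** * Drawings of antipodal cycles *)

Section CycleDrawing.
Variables (R : realType) (k : nat).
Hypothesis k_gt2 : (2 < k)%N.
Local Notation n := k.*2.
Local Notation G := (cycle_graph k_gt2).
Implicit Types (e : {set 'I_n}) (v : 'I_n).

Definition edge_hi e : nat := (\max_(v in e) val v)%N.
(** An edge has two endpoints, so taking the larger one off the sum leaves the smaller one. *)
Definition edge_lo e : nat := (\sum_(v in e) val v - edge_hi e)%N.

(* The path 0, 1, ..., n-1 lies on the horizontal axis and the edge from n-1 to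
   0 bulges above it. *)
Definition line_pos v : plane R := ((val v)%:R, 0).
Definition line_arc e (t : R) : plane R :=
  ((edge_lo e)%:R + t * ((edge_hi e)%:R - (edge_lo e)%:R),
   if edge_hi e == (edge_lo e).+1 then 0 else t * (1 - t)).

Lemma cycle_edgeP e : e \in edges G ->
  (exists2 q, (q.+1 < n)%N & [/\ e = cycle_edge k_gt2 q, edge_lo e = q & edge_hi e = q.+1]) \/
  [/\ e = cycle_edge k_gt2 n.-1, edge_lo e = 0%N & edge_hi e = n.-1].
Proof.
case/imsetP => q _ ->.
have q1 : vtx k_gt2 q != vtx k_gt2 q.+1 by apply: vtx_neq; lia.
have qn := ltn_ord q.
rewrite /edge_lo /edge_hi !big_setU1 ?inE//= !big_set1 /= (modn_small qn).
have [qn'|qn'] := ltnP q.+1 n.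
  by left; exists (val q) => //; rewrite modn_small//; split => //=; lia.
have qE : q = n.-1 :> nat by lia.
right; rewrite qE prednK ?modnn; last by lia.
by split => //; lia.
Qed.

Lemma edge_lo_hi e : e \in edges G -> (edge_lo e < edge_hi e)%N.
Proof. by move=> /cycle_edgeP[[q _ [_ -> ->]]|[_ -> ->]]; lia. Qed.

Lemma edge_lo_hiE e : e \in edges G ->
  e = [set vtx k_gt2 (edge_lo e); vtx k_gt2 (edge_hi e)]%SET.
Proof.
move=> /cycle_edgeP[[q _ [-> -> ->]]//|[-> -> ->]].
rewrite /cycle_edge finset.setUC prednK; last by lia.
by congr [set _; _]%SET; apply: val_inj; rewrite /= modnn mod0n.
Qed.

Lemma edge_hi_lt e : e \in edges G -> (edge_hi e < n)%N.
Proof. by move=> /cycle_edgeP[[q ? [_ _ ->]]|[_ _ ->]]; lia. Qed.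

Lemma line_pos_inj : injective line_pos.
Proof. by move=> u v [] /eqP; rewrite eqr_nat => /eqP/val_inj. Qed.

Lemma line_arc_simple e : e \in edges G -> simple_arc (line_arc e).
Proof.
move=> eG; split; last first.
  move=> s t _ _ [] /addrI + _; apply: mulIf.
  by rewrite subr_eq0 eqr_nat; have := edge_lo_hi eG; case: ltngtP.
have h1 : continuous (fun t : R =>
    (edge_lo e)%:R + t * ((edge_hi e)%:R - (edge_lo e)%:R)).
  by move=> t; apply: cvgD; [exact: cvg_cst|apply: cvgMr_tmp; exact: cvg_id].
have h2 : continuous (fun t : R =>
    if edge_hi e == (edge_lo e).+1 then 0 else t * (1 - t)).
  move=> t; case: (edge_hi e == _); first exact: cst_continuous.
  apply: (@cvgM _ _ _ _ id (fun s => 1 - s)); first exact: cvg_id.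
  by apply: cvgB; [exact: cvg_cst|exact: cvg_id].
by apply: continuous_subspaceT => t; exact: cvg_pair (h1 t) (h2 t).
Qed.

Lemma line_arc_ends e : e \in edges G ->
  [set line_arc e 0; line_arc e 1] = [set line_pos v | v in [set` e]].
Proof.
move=> eG.
have lo := edge_lo_hi eG; have hi := edge_hi_lt eG.
have e0 : line_arc e 0 = line_pos (vtx k_gt2 (edge_lo e)).
  rewrite /line_arc /line_pos /= !mul0r addr0 modn_small; last by lia.
  by case: ifP.
have e1 : line_arc e 1 = line_pos (vtx k_gt2 (edge_hi e)).
  rewrite /line_arc /line_pos /= !mul1r subrr addrC subrK modn_small//.
  by case: ifP.
rewrite e0 e1; have eE := edge_lo_hiE eG.
have := set22 (vtx k_gt2 (edge_lo e)) (vtx k_gt2 (edge_hi e)).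
have := set21 (vtx k_gt2 (edge_lo e)) (vtx k_gt2 (edge_hi e)).
rewrite -eE => lo_in hi_in.
apply/seteqP; split => [p [->|->]|_ [v /= ve <-]].
- by exists (vtx k_gt2 (edge_lo e)).
- by exists (vtx k_gt2 (edge_hi e)).
- by move: ve; rewrite {1}eE => /set2P[] ->; [left|right].
Qed.

Lemma line_arc_avoid e v : e \in edges G -> ~ open_curve (line_arc e) (line_pos v).
Proof.
move=> eG [t /=]; rewrite in_itv /= => /andP[t0 t1] [].
case: ifP => [/eqP -> h _|_ _ h].
  rewrite -natr1 addrAC subrr add0r mulr1 in h.
  have : ((edge_lo e)%:R : R) < (val v)%:R by rewrite -h; lra.
  have : (val v)%:R < ((edge_lo e).+1%:R : R) by rewrite -h -natr1; lra.
  by rewrite !ltr_nat; lia.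
have : 0 < t * (1 - t) by rewrite mulr_gt0// subr_gt0.
by rewrite h ltxx.
Qed.

Definition line_drawing : graph_drawing R G :=
  @GraphDrawing R G line_pos line_arc line_pos_inj line_arc_simple
    line_arc_ends line_arc_avoid.

(** Edges on the axis project into distinct intervals between consecutive integers; the remaining
    open edge has positive ordinates. *)
Lemma line_drawing_planar : planar_drawing line_drawing.
Proof.
move=> e e' eG e'G ee'; apply/seteqP; split => // p [] [s /= + <-] [t /= +].
rewrite !in_itv /= => /andP[s0 s1] /andP[t0 t1].
have st0 : 0 < s * (1 - s) by rewrite mulr_gt0// subr_gt0.
have tt0 : 0 < t * (1 - t) by rewrite mulr_gt0// subr_gt0.
rewrite /line_arc.
have [[q qn [eE -> ->]]|[eE -> ->]] := cycle_edgeP eG;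
have [[q' qn' [eE' -> ->]]|[eE' -> ->]] := cycle_edgeP e'G.
- rewrite !eqxx -!natr1 => -[h].
  have : (q%:R : R) < q'.+1%:R by rewrite -natr1; lra.
  have : (q'%:R : R) < q.+1%:R by rewrite -natr1; lra.
  rewrite !ltr_nat => h1 h2; move/eqP: ee'; apply; rewrite eE eE'.
  by congr cycle_edge; lia.
- rewrite eqxx; have -> : (n.-1 == 1)%N = false by lia.
  by move=> [_] h; rewrite h ltxx in tt0.
- rewrite eqxx; have -> : (n.-1 == 1)%N = false by lia.
  by move=> [_] h; rewrite -h ltxx in st0.
- by move/eqP: ee'; case; rewrite eE eE'.
Qed.

Lemma line_drawing_nonneg p : drawn_points line_drawing p -> 0 <= p.2.
Proof.
case=> [[v _ <-]//|[e _ [t /= + <-]]]; rewrite in_itv /= => /andP[t0 t1].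
by case: ifP => // _; rewrite mulr_ge0 ?subr_ge0// ltW.
Qed.

(** The drawing lies in the closed upper half-plane, so the vertical ray below a vertex joins points
    close to it with infinity. *)
Lemma cycle_outerplanar : outerplanar R G.
Proof.
exists line_drawing; first exact: line_drawing_planar.
move=> v; apply/closure_normP => eps eps0.
pose ray := [set line_pos v + t *: ((0, -1) : plane R) | t in `]0, +oo[%classic].
have rayE (t : R) : line_pos v + t *: ((0, -1) : plane R) = ((val v)%:R, - t).
  congr pair; rewrite /= -?[_ *: _]/(_ * _).
    by rewrite mulr0 addr0.
  by rewrite mulrN1 add0r.
exists ((val v)%:R, - (eps / 2)); last first.
  rewrite prod_norm_lt /= subrr normr0 eps0 opprK add0r gtr0_norm; lra.
have ray_out : ray `<=` ~` drawn_points line_drawing.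
  move=> _ [t /= + <-] /line_drawing_nonneg; rewrite rayE in_itv /= andbT.
  by move=> t0; rewrite oppr_ge0 leNgt t0.
have rayP (t : R) : 0 < t -> ray ((val v)%:R, - t).
  by move=> t0; exists t; [rewrite /= in_itv /= t0|rewrite rayE].
have e20 : 0 < eps / 2 by lra.
split; first exact/ray_out/rayP.
move=> /bounded_planeP[M hM].
have : `|(((val v)%:R, - (`|M| + 1)) : plane R)| <= M.
  apply: hM; exists ray; last by apply: rayP; rewrite ltr_wpDl.
  split => //; first exact: rayP.
  by apply: connected_line; exact: interval_is_interval.
rewrite leNgt; apply/negP; rewrite negbK.
rewrite prod_normE lt_max /= normrN (ger0_norm (_ : 0 <= `|M| + 1)) ?addr_ge0//.
by apply/orP; right; have := ler_norm M; lra.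
Qed.

End CycleDrawing.

(** * Consequences of having no edge-edge or edge-region crossings *)

Section CrossingFacts.
Variable R : realType.

Lemma card_le1_eq (T : Type) (A : set T) (j : nat) (x y : T) :
  (A #= `I_j)%card -> (j <= 1)%N -> A x -> A y -> x = y.
Proof.
move=> /card_eqP[f] j1 Ax Ay.
pose x' : A := SigSub (mem_set Ax); pose y' : A := SigSub (mem_set Ay).
have fxy : f x' = f y'.
  by apply: val_inj; have := set_valP (f x'); have := set_valP (f y') => /=; lia.
suff : x' = y' by move=> /(congr1 val).
by apply: (@inj _ _ _ f); rewrite ?inE.
Qed.

Lemma one_component (A : set (plane R)) (a b : plane R) :
  (components A #= `I_1)%card -> A a -> A b -> connected_component A a b.
Proof.
move=> cA Aa Ab.
have -> : connected_component A a = connected_component A b.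
  by apply: (card_le1_eq cA) => //; [exists a|exists b].
exact: connected_component_refl.
Qed.

Variables (C : clustered_graph) (D : drawing R C).

Lemma no_edge_crossing : edge_edge_crossings D 0 -> planar_drawing D.
Proof.
case=> j jP /esym/eqP; rewrite sum_nat_eq0 => /forall_inP j0 e e' eC e'C ee'.
have {}j0 f f' : f \in edges C -> f' \in edges C ->
    (enum_rank f < enum_rank f')%N -> j f f' = 0%N.
  move=> fC f'C ff'; have := j0 f fC; rewrite sum_nat_eq0 => /forall_inP/(_ f').
  by rewrite f'C ff' => /(_ isT)/eqP.
have [lt|lt|/val_inj/enum_rank_inj eq] := ltngtP (enum_rank e) (enum_rank e').
- by have := jP e e' eC e'C ee'; rewrite j0// II0 card_eq0 => /eqP.
- rewrite setIC; have := jP e' e e'C eC; rewrite eq_sym j0// II0 card_eq0.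
  by move=> /(_ ee')/eqP.
- by rewrite eq eqxx in ee'.
Qed.

(** When half the number of intersections, rounded down, is 0, at most one intersection remains. *)
Lemma edge_region_meet1 e mu (p q : plane R) : edge_region_crossings D 0 ->
  e \in edges C -> is_cluster mu ->
  (open_curve (edge_arc D e) `&` closed_curve (border D mu)) p ->
  (open_curve (edge_arc D e) `&` closed_curve (border D mu)) q -> p = q.
Proof.
case=> j jP /esym/eqP; rewrite sum_nat_eq0 => /forall_inP j0 eC muC.
have := j0 e eC; rewrite sum_nat_eq0 => /forall_inP/(_ mu muC)/eqP j1.
apply: (card_le1_eq (jP e mu eC muC)); lia.
Qed.

(** If [e t] were in the region but off its border, the arc would meet the border both before and
    after [t], as its ends lie outside. *)
Lemma arc_region_sub (e c : R -> plane R) (t : R) : simple_arc e ->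
  ~ closed_region c (e 0) -> ~ closed_region c (e 1) ->
  (forall p q, (open_curve e `&` closed_curve c) p ->
    (open_curve e `&` closed_curve c) q -> p = q) ->
  0 <= t <= 1 -> closed_region c (e t) -> (open_curve e `&` closed_curve c) (e t).
Proof.
move=> [ce ie] D0 D1 P1 /andP[t0 t1] Dt.
have t0' : 0 < t.
  by rewrite lt_neqAle t0 andbT; apply/eqP => e0; apply: D0; rewrite e0.
have t1' : t < 1.
  by rewrite lt_neqAle t1 andbT; apply/eqP => e1; apply: D1; rewrite -e1.
have et : open_curve e (e t) by exists t => //=; rewrite in_itv /= t0'.
split => //; apply: contrapT => nJt.
have sub (i : interval R) (s : R) : [set` i] `<=` `[0, 1]%classic -> s \in i -> t \in i ->
    (forall r, r \in i -> ~ closed_curve c (e r)) -> closed_region c (e s).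
  move=> i01 si ti nJ.
  have comp : connected_component (~` closed_curve c) (e s) (e t).
    exists (e @` [set` i]); last by exists t.
    split; first by exists s.
      by move=> _ [r ri <-]; exact: nJ.
    apply: connected_continuous_connected.
      by apply/connected_intervalP; exact: interval_is_interval.
    exact: continuous_subspaceW ce.
  apply: contrapT => nDs; exact: (notin_region_component nDs comp) Dt.
have J0 (r : R) : 0 <= r <= 1 -> closed_curve c (e r) -> open_curve e (e r).
  move=> /andP[r0 r1] Jr; exists r => //=; rewrite in_itv /= !lt_neqAle r0 r1 !andbT.
  apply/andP; split; apply/eqP => re.
    by apply: D0; left; rewrite re.
  by apply: D1; left; rewrite -re.
have inI (r : R) : 0 <= r <= 1 -> r \in `[0, 1] by rewrite in_itv.
(* If the meeting point comes before [t], the part after [t] joins [e t] to [e 1] off the border;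
   otherwise the part before [t] joins it to [e 0]. *)
have [[s /andP[s0 st] Js]|noJ] := pselect (exists2 s : R, 0 <= s <= t & closed_curve c (e s)).
  apply: D1; apply: (sub `[t, 1]).
  - by move=> r /=; rewrite !in_itv /= => /andP[tr ->]; rewrite (le_trans t0 tr).
  - by rewrite in_itv /= lexx t1.
  - by rewrite in_itv /= lexx t1.
  - move=> r; rewrite in_itv /= => /andP[tr r1] Jr.
    have s1 : 0 <= s <= 1 by rewrite s0 (le_trans st).
    have r01 : 0 <= r <= 1 by rewrite r1 (le_trans t0).
    have srE : s = r.
      by apply: ie; [exact: inI|exact: inI|apply: P1; split => //; exact: J0].
    have tE : t = s by apply/eqP; rewrite eq_le st {1}srE tr.
    by apply: nJt; rewrite tE.
apply: D0; apply: (sub `[0, t]).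
- by move=> r /=; rewrite !in_itv /= => /andP[-> rt]; rewrite (le_trans rt t1).
- by rewrite in_itv /= lexx t0.
- by rewrite in_itv /= lexx t0.
- by move=> r; rewrite in_itv /= => rt Jr; apply: noJ; exists r.
Qed.

End CrossingFacts.

(** * Parity relations in a drawing of an antipodal cycle *)

Section AntipodalDrawing.
Variables (R : realType) (k : nat).
Hypothesis k_gt2 : (2 < k)%N.
Local Notation n := k.*2.
Variable D : drawing R (antipodal_cycle k_gt2).
Hypothesis edge_edge0 : edge_edge_crossings D 0.
Hypothesis edge_region0 : edge_region_crossings D 0.

Let P (q : nat) : plane R := pos D (vtx k_gt2 q).
Let arc (q : nat) : R -> plane R := edge_arc D (cycle_edge k_gt2 q).
Let bd (m : nat) : R -> plane R := border D (cluster_node k_gt2 m).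

Let P_neq p q : (p < q)%N -> (q < p + n)%N -> P p <> P q.
Proof. by move=> pq qn /pos_inj/eqP; apply/negP; exact: vtx_neq. Qed.

Let P_region q m : closed_region (bd m) (P q) <-> cluster_of k_gt2 q = cluster_of k_gt2 m.
Proof.
apply: (iff_trans (region_vertex D _ (cluster_node_is_cluster k_gt2 m))).
by rewrite in_cluster_node cluster_of_vtx; split => /eqP.
Qed.

Let P_notin m q : (m < k)%N ->
  (q < m)%N \/ (m < q < m + k)%N \/ (m + k < q < m + n)%N -> ~ closed_region (bd m) (P q).
Proof.
move=> mk h /P_region; case: h => [qm|[qm|qm]].
- by apply/eqP/cluster_of_neq; lia.
- by apply/eqP; rewrite eq_sym; apply: cluster_of_neq; lia.
- by rewrite -(cluster_ofD _ m); apply/eqP; rewrite eq_sym; apply: cluster_of_neq; lia.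
Qed.

Let bd_simple m : simple_closed_curve (bd m).
Proof. exact/border_simple/cluster_node_is_cluster. Qed.

Let arc_is_simple q : simple_arc (arc q).
Proof. exact/arc_simple/cycle_edge_in. Qed.

(** A drawing does not prescribe which endpoint has parameter 0, so both orientations have to be
    treated below. *)
Let arc_endsP q : (arc q 0 = P q /\ arc q 1 = P q.+1) \/
                  (arc q 0 = P q.+1 /\ arc q 1 = P q).
Proof.
have E := arc_ends D (cycle_edge_in k_gt2 q).
have in_ends p : [set arc q 0; arc q 1] p -> p = P q \/ p = P q.+1.
  by rewrite /arc E => -[v /= /set2P[] -> <-]; [left|right].
have ne : arc q 0 <> arc q 1.
  have [_ ie] := arc_is_simple q.
  move=> /ie; rewrite !in_itv /= !lexx !ler01 => /(_ isT isT)/eqP.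
  by rewrite eq_sym oner_eq0.
have := in_ends _ (or_introl erefl); have := in_ends _ (or_intror erefl).
move=> [e1|e1] [e0|e0]; [|by right|by left|]; by case: ne; rewrite e0 e1.
Qed.

Let arc_pointP q (t : R) : 0 <= t <= 1 ->
  [\/ open_curve (arc q) (arc q t), arc q t = P q | arc q t = P q.+1].
Proof.
move=> /andP[t0 t1]; have E := arc_endsP q.
have [->|t0'] := eqVneq t 0; first by case: E => -[-> _]; [constructor 2|constructor 3].
have [->|t1'] := eqVneq t 1; first by case: E => -[_ ->]; [constructor 3|constructor 2].
by constructor 1; exists t => //=; rewrite in_itv /= !lt_neqAle eq_sym t0' t0 t1' t1.
Qed.

Let arcs_disjoint p q (s t : R) : (p.+1 < q)%N -> (q.+1 < p + n)%N ->
  0 <= s <= 1 -> 0 <= t <= 1 -> arc p s <> arc q t.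
Proof.
move=> pq qp hs ht E.
have ee : cycle_edge k_gt2 p != cycle_edge k_gt2 q.
  apply/eqP => /setP/(_ (vtx k_gt2 p)); rewrite set21 => /esym/set2P[] /eqP;
  by apply/negP; apply: vtx_neq; lia.
have pl := no_edge_crossing edge_edge0 (cycle_edge_in _ _) (cycle_edge_in _ _) ee.
have avoid r v : ~ open_curve (arc r) (P v).
  by apply: arc_avoid; exact: cycle_edge_in.
have [h1|E1|E1] := arc_pointP p hs; have [h2|E2|E2] := arc_pointP q ht;
  rewrite ?E1 ?E2 in E.
- have : (open_curve (arc p) `&` open_curve (arc q)) (arc p s) by split; rewrite // E.
  by rewrite [X in X _]pl.
- by apply: (avoid p q); rewrite -E.
- by apply: (avoid p q.+1); rewrite -E.
- by apply: (avoid q p); rewrite E.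
- by apply: P_neq E; lia.
- by apply: P_neq E; lia.
- by apply: (avoid q p.+1); rewrite E.
- by apply: P_neq E; lia.
- by apply: P_neq E; lia.
Qed.

Let T N v q := arc_parity (P v) (arc q) N.
Let t u v := upper (P u - P v).

Let edge_edge_eq p q : (p.+1 < q)%N -> (q.+1 < p + n)%N -> \forall N \near \oo,
  (T N p q (+) T N p.+1 q) (+) (T N q p (+) T N q.+1 p) =
  (t p q (+) t p.+1 q) (+) (t p q.+1 (+) t p.+1 q.+1).
Proof.
move=> pq qp.
have [cp _] := arc_is_simple p; have [cq _] := arc_is_simple q.
have := arc_arc_parity cp cq (fun s u => @arcs_disjoint p q s u pq qp).
apply: filterS => N; rewrite /T /t.
have [[-> ->]|[-> ->]] := arc_endsP p; have [[-> ->]|[-> ->]] := arc_endsP q => //.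
- by rewrite [X in _ = X -> _]addbC [X in _ (+) X = _ -> _]addbC.
- rewrite [X in X (+) _ = _ -> _]addbC => ->.
  by congr (_ (+) _); rewrite addbC.
- rewrite [X in X (+) _ = _ -> _]addbC [X in _ (+) X = _ -> _]addbC => ->.
  by rewrite addbC; congr (_ (+) _); rewrite addbC.
Qed.

(** The choice is made on vertices and not on natural indices, which makes the parity periodic in
    the index. *)
Lemma winding_exists : exists w : nat -> 'I_n -> bool, forall m (v : 'I_n),
  ~ closed_region (bd m) (pos D v) -> winds (bd m) (P m) (P (m + k)) (pos D v) (w m v).
Proof.
have /choice[w wP] : forall mv : nat * 'I_n, exists w : bool,
    ~ closed_region (bd mv.1) (pos D mv.2) ->
    winds (bd mv.1) (P mv.1) (P (mv.1 + k)) (pos D mv.2) w.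
  move=> [m v] /=; have [i|ni] := pselect (closed_region (bd m) (pos D v)).
    by exists false.
  have [cc _ _] := bd_simple m.
  by have [w wP] := region_winds (P m) (P (m + k)) cc ni; exists w.
by exists (fun m v => w (m, v)) => m v; exact: (wP (m, v)).
Qed.

Let w0 := projT1 (cid winding_exists).
Let w m q := w0 m (vtx k_gt2 q).

Let wP m q : ~ closed_region (bd m) (P q) ->
  winds (bd m) (P m) (P (m + k)) (P q) (w m q).
Proof. exact: (projT2 (cid winding_exists)). Qed.

Let P_in m : closed_region (bd m) (P m).
Proof. exact/P_region. Qed.

Let P_in' m : closed_region (bd m) (P (m + k)).
Proof. by apply/P_region; rewrite cluster_ofD. Qed.

(** The edge meets the region in at most one point of its border; this possible contact forms the
    set [X] that is removed. *)
Let cluster_edge_eq m q : (m < k)%N ->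
  (q.+1 < m \/ (m < q /\ q.+1 < m + k) \/ (m + k < q /\ q.+1 < m + n))%N ->
  \forall N \near \oo,
  (T N m q (+) T N (m + k) q) (+) (w m q (+) w m q.+1) =
  (t m q (+) t (m + k) q) (+) (t m q.+1 (+) t (m + k) q.+1).
Proof.
move=> mk h.
have out0 : ~ closed_region (bd m) (P q) by apply: P_notin => //; lia.
have out1 : ~ closed_region (bd m) (P q.+1) by apply: P_notin => //; lia.
pose X := open_curve (arc q) `&` closed_curve (bd m).
have X1 p p' : X p -> X p' -> p = p'.
  exact: edge_region_meet1 edge_region0 (cycle_edge_in _ _) (cluster_node_is_cluster _ _).
have [cq iq] := arc_is_simple q.
have avoid v : ~ X (P v) by case=> + _; apply: arc_avoid; exact: cycle_edge_in.
have Dq s : 0 <= s <= 1 -> closed_region (bd m) (arc q s) -> X (arc q s).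
  apply: arc_region_sub => //.
    by case: (arc_endsP q) => -[-> _].
  by case: (arc_endsP q) => -[_ ->].
have main := @region_arc_parity R (bd m) (P m) (P (m + k)) X (arc q) _ _
  (bd_simple m) (P_in m) (P_in' m) (@subIsetr _ _ _) X1 (avoid _) (avoid _) cq Dq.
have [[e0 e1]|[e0 e1]] := arc_endsP q.
  have := main (w m q) (w m q.+1); rewrite e0 e1 => /(_ (wP out0) (wP out1)).
  exact: filterS.
have := main (w m q.+1) (w m q); rewrite e0 e1 => /(_ (wP out1) (wP out0)).
by apply: filterS => N; rewrite [w m q.+1 (+) _]addbC => ->; rewrite addbC.
Qed.

Let t_anti u v : (u < v)%N -> (v < u + n)%N -> t v u = ~~ t u v.
Proof.
move=> uv vn; rewrite /t -opprB upperN // subr_eq0; apply/eqP.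
exact: P_neq.
Qed.

(** Exchanging the clusters reverses four comparisons, and the four negations cancel. Connectedness
    of either difference can thus be used. *)
Let clusters_parity_sym m m' : (m < m' < k)%N ->
  clusters_parity k w t m' m -> clusters_parity k w t m m'.
Proof.
move=> mm'; rewrite /clusters_parity addbC => ->.
rewrite (t_anti (u := m)) ?(t_anti (u := m + k) (v := m' + k)); try lia.
rewrite (t_anti (u := m) (v := m' + k)) ?(t_anti (u := m') (v := m + k)); try lia.
Qed.

Let separated_parity m m' : (m < k)%N -> (m' < k)%N -> m <> m' ->
  (components (closed_region (bd m) `\` closed_region (bd m')) #= `I_1)%card ->
  clusters_parity k w t m m'.
Proof.
move=> mk m'k mm' c1.
have out a b : (a < k)%N -> (b < k)%N -> a <> b -> ~ closed_region (bd a) (P b).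
  move=> ak bk ab; have [ab'|ab'|//] := ltngtP a b.
  - by apply: P_notin => //; lia.
  - by apply: P_notin => //; lia.
have out' a b : (a < k)%N -> (b < k)%N -> a <> b -> ~ closed_region (bd a) (P (b + k)).
  move=> ak bk ab; have [ab'|ab'|//] := ltngtP a b.
  - by apply: P_notin => //; lia.
  - by apply: P_notin => //; lia.
have m'm : m' <> m by move=> e; exact: mm'.
apply: (@region_region_parity R (bd m) (bd m') (P m) (P (m + k)) (P m') (P (m' + k))).
- exact: bd_simple.
- exact: bd_simple.
- exact: P_in.
- exact: P_in'.
- by apply: one_component => //; split => //; [exact: out|exact: out'].
- by apply: wP; exact: out.
- by apply: wP; exact: out'.
- by apply: wP; exact: out.
- by apply: wP; exact: out'.
Qed.

(** Otherwise each pair has a connected difference in one direction, and one [N], fine enough for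
    the finitely many edge relations, contradicts [cycle_clusters_cross]. *)
Lemma three_clusters_cross (j : 'I_k -> 'I_k -> nat) (a b c : 'I_k) : (a < b < c)%N ->
  (forall x y : 'I_k, x != y -> j x y = 0%N ->
    (components (closed_region (bd x) `\` closed_region (bd y)) #= `I_1)%card \/
    (components (closed_region (bd y) `\` closed_region (bd x)) #= `I_1)%card) ->
  (0 < j a b + j a c + j b c)%N.
Proof.
move=> abc jP; rewrite lt0n; apply/eqP => j0.
have par (x y : 'I_k) : (x < y)%N -> j x y = 0%N -> clusters_parity k w t x y.
  move=> xy /jP[]; first by rewrite neq_ltn xy.
    by apply: separated_parity => //; lia.
  move=> h; have yk := ltn_ord y; apply: clusters_parity_sym; first by lia.
  by apply: separated_parity => //; lia.
have ee : \forall N \near \oo, forall p q : 'I_(k * 4), (p.+1 < q)%N -> (q.+1 < p + n)%N ->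
    (T N p q (+) T N p.+1 q) (+) (T N q p (+) T N q.+1 p) =
    (t p q (+) t p.+1 q) (+) (t p q.+1 (+) t p.+1 q.+1).
  apply: filter_forall => p; apply: filter_forall => q.
  have [h1|h1] := ltnP p.+1 q; last by near=> N.
  have [h2|h2] := ltnP q.+1 (p + n); last by near=> N.
  by have := edge_edge_eq h1 h2; apply: filterS.
have ce : \forall N \near \oo, forall (m : 'I_k) (q : 'I_(k * 4)),
    (q.+1 < m \/ (m < q /\ q.+1 < m + k) \/ (m + k < q /\ q.+1 < m + n))%N ->
    (T N m q (+) T N (m + k) q) (+) (w m q (+) w m q.+1) =
    (t m q (+) t (m + k) q) (+) (t m q.+1 (+) t (m + k) q.+1).
  apply: filter_forall => m; apply: filter_forall => q.
  have [h|h] := pselect (q.+1 < m \/ (m < q /\ q.+1 < m + k) \/ (m + k < q /\ q.+1 < m + n))%N;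
    last by near=> N.
  by have := cluster_edge_eq (ltn_ord m) h; apply: filterS.
have [N [eeN ceN]] := filter_ex (filterI ee ce).
apply: (@cycle_clusters_cross k (T N) w t _ _ _ _ _ _ a b c) => //.
- move=> p q qk pq qp; have pk : (p < k * 4)%N by lia.
  exact: (eeN (Ordinal pk) (Ordinal qk)).
- by move=> m q mk qk; exact: (ceN (Ordinal mk) (Ordinal qk)).
- by move=> v q; rewrite /T /P vtxD.
- by move=> m v; rewrite /w vtxD.
- by move=> u v; rewrite /t /P vtxD.
- by move=> u v uv; apply: t_anti; lia.
- by apply: par; lia.
- by apply: par; lia.
- by apply: par; lia.
Unshelve. all: by end_near. Qed.

End AntipodalDrawing.

(** * Averaging over triples *)

Section Counting.
Local Open Scope nat_scope.

Lemma leq_sum_inj (I J : finType) (h : I -> J) (Q : pred I) (S : pred J)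
    (F : J -> nat) : injective h -> (forall x, Q x -> S (h x)) ->
  \sum_(x | Q x) F (h x) <= \sum_(y | S y) F y.
Proof.
move=> hi QS.
have -> : \sum_(x | Q x) F (h x) = \sum_(y in [set h x | x in Q]%SET) F y.
  by rewrite big_imset//= => x y _ _; exact: hi.
rewrite [X in _ <= X](bigID (mem [set h x | x in Q]%SET)) /=.
rewrite [X in _ <= X + _](_ : _ = \sum_(y in [set h x | x in Q]%SET) F y) ?leq_addr//.
apply: eq_bigl => y; apply/andP/idP => [[]//|yQ]; split => //.
by case/imsetP: yQ => x Qx ->; exact: QS.
Qed.

(** Each of the [k ^ 3] ordered triples contributes at least 1 to a sum in which every ordered pair
    is counted [3 * k] times. *)
Lemma triple_count k (g : 'I_k -> 'I_k -> nat) :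
  (forall a b c : 'I_k, a < b < c ->
    0 < (g a b + g b a) + (g a c + g c a) + (g b c + g c b)) ->
  k ^ 2 <= 3 * k + 6 * \sum_(a < k) \sum_(b < k) g a b.
Proof.
case: k g => [|k'] g; first by []; set k := k'.+1 => gP.
(* The diagonal term lets triples with a repeated index contribute too; it costs the summand [3 * k]
   of the conclusion. *)
pose f a b := (a == b) + (g a b + g b a).
have fP a b c : 0 < f a b + f a c + f b c.
  rewrite /f; have [//|ab] := eqVneq a b.
  have [|ac] := eqVneq a c; first by lia.
  have [|bc] := eqVneq b c; first by lia.
  move: ab ac bc; rewrite -!val_eqE /= => ab ac bc.
  have perm : a < b < c \/ a < c < b \/ b < a < c \/ b < c < a \/
      c < a < b \/ c < b < a by lia.
  by case: perm => [h|[h|[h|[h|[h|h]]]]]; have := gP _ _ _ h; lia.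
pose S := \sum_(a < k) \sum_(b < k) f a b.
have SE : S = k + 2 * \sum_(a < k) \sum_(b < k) g a b.
  rewrite /S; under eq_bigr do rewrite big_split /= big_split /=.
  rewrite !big_split /= [X in _ + (_ + X)]exchange_big /= addnn mul2n; congr (_ + _).
  have diag (a : 'I_k) : \sum_(b < k) (a == b) = 1.
    by rewrite (bigD1 a)//= eqxx big1// => b; rewrite eq_sym => /negbTE ->.
  by under eq_bigr do rewrite diag; rewrite sum1_card card_ord.
have : \sum_(a < k) \sum_(b < k) \sum_(c < k) 1 <=
       \sum_(a < k) \sum_(b < k) \sum_(c < k) (f a b + f a c + f b c).
  by do 3![apply: leq_sum => ? _].
have -> : \sum_(a < k) \sum_(b < k) \sum_(c < k) 1 = k * k ^ 2.
  by rewrite !(sum_nat_const, card_ord) !muln1.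
have -> : \sum_(a < k) \sum_(b < k) \sum_(c < k) (f a b + f a c + f b c) = k * (3 * S).
  under eq_bigr do under eq_bigr do rewrite 2!big_split /= sum_nat_const card_ord.
  under eq_bigr do rewrite 2!big_split /= -big_distrr /= sum_nat_const card_ord.
  rewrite 2!big_split /= -!big_distrr /= sum_nat_const card_ord -/S.
  by lia.
rewrite leq_pmul2l// SE; lia.
Qed.

End Counting.

(** * The quadratic lower bound *)

Lemma antipodal_crossings (R : realType) (k : nat) (k_gt2 : (2 < k)%N)
    (D : drawing R (antipodal_cycle k_gt2)) (gamma : nat) :
  crossing_drawing D 0 0 gamma -> (k ^ 2 <= 3 * k + 6 * gamma)%N.
Proof.
case=> ee er [j jP ->].
pose N (x : 'I_k) := cluster_node k_gt2 x.
have NK (x : 'I_k) : cluster_of k_gt2 x = x by apply: val_inj; rewrite /= modn_small.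
have N_inj : injective N by move=> x y [] xy; rewrite -(NK x) -(NK y); exact: val_inj.
have N_inc (x y : 'I_k) : x != y -> incomparable (N x) (N y).
  by move=> xy; apply: incomparable_cluster_node; rewrite !NK.
(* Crossings are recorded for one order of each pair, given by the ranks; the other order gets 0. *)
pose g (x y : 'I_k) := if (enum_rank (N x) < enum_rank (N y))%N then j (N x) (N y) else 0%N.
have : (k ^ 2 <= 3 * k + 6 * \sum_(x < k) \sum_(y < k) g x y)%N.
  apply: triple_count => a b c abc.
  apply: (three_clusters_cross ee er abc (j := fun x y => g x y + g y x)%N).
  move=> x y xy; rewrite /g.
  have comp (u v : 'I_k) : u != v -> j (N u) (N v) = 0%N ->
     (components (closed_region (border D (N u)) `\`
                  closed_region (border D (N v))) #= `I_1)%card.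
    move=> uv j0; have := jP (N u) (N v); rewrite j0; apply.
    - exact: cluster_node_is_cluster.
    - exact: cluster_node_is_cluster.
    - exact: N_inc.
  have [lt|lt|] := ltngtP (enum_rank (N x)) (enum_rank (N y)).
  - by rewrite addn0 => j0; left; exact: comp.
  - by rewrite add0n => j0; right; apply: comp; rewrite // eq_sym.
  - by move=> /val_inj/enum_rank_inj/N_inj xyE; rewrite xyE eqxx in xy.
move=> /leq_trans; apply; rewrite leq_add2l leq_mul2l /=.
pose F mu := (\sum_(nu | [&& is_cluster nu, incomparable mu nu
  & (enum_rank mu < enum_rank nu)%N]) j mu nu)%N.
apply: (@leq_trans (\sum_(x < k) F (N x))%N); last first.
  by apply: (@leq_sum_inj _ _ N xpredT) => // x _; exact: cluster_node_is_cluster.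
apply: leq_sum => x _; rewrite /g -big_mkcond /=.
apply: (@leq_sum_inj _ _ N) => // y xy; apply/and3P; split => //.
  exact: cluster_node_is_cluster.
by apply: N_inc; apply: contraTneq xy => ->; rewrite ltnn.
Qed.

Theorem theorem11 (R : realType) :
  exists F : nat -> clustered_graph,
  [/\ forall i, [/\ ~ c_connected (F i), flat (F i) & outerplanar R (F i)],
      forall N : nat, exists i, (N <= #|F i|)%N
    & exists c : R, exists n0 : nat, 0 < c /\
        forall i, (n0 <= #|F i|)%N ->
        forall (D : drawing R (F i)) (gamma : nat),
          crossing_drawing D 0%N 0%N gamma -> c * (#|F i|%:R ^+ 2) <= gamma%:R].
Proof.
have k_gt2 i : (2 < i.+3)%N by [].
have card i : #|antipodal_cycle (k_gt2 i)| = i.+3.*2 by rewrite card_ord.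
exists (fun i => antipodal_cycle (k_gt2 i)); split.
- move=> i; split; [exact: antipodal_not_c_connected|exact: antipodal_flat|].
  exact: cycle_outerplanar.
- by move=> N; exists N; rewrite card; lia.
(* For [n = 2 * k] and [k >= 6], the term [3 * k] is at most half of [k ^ 2], so
   [k ^ 2 <= 12 * gamma] and [n ^ 2 <= 48 * gamma]. *)
exists 48^-1, 12%N; split; first by lra.
move=> i; rewrite card => i12 D gamma /antipodal_crossings.
set k := i.+3 in i12 * => kg.
have : (k.*2 ^ 2 <= 48 * gamma)%N.
  have : (6 * k <= k ^ 2)%N by rewrite -mulnn leq_mul2r; apply/orP; right; lia.
  by rewrite -muln2 expnMn; lia.
by rewrite -(ler_nat R) natrM natrX -ler_pdivrMl.
Qed.
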